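(* The green phase separation curve is the graph of a Lipschitz function with Lipschitz norm at most $\sqrt3$, and this graph has no points in common with the critical percolation lines $\{p_2=p_c\}$ and $\{p_3=p_c\}$, except on the boundary of the triangle $\mathcal T$; off the boundary of $\mathcal T$ it lies strictly below both lines. Precisely: identify $\mathcal T$ with an equilateral triangle in the plane via $p\mapsto(x,y)=\bigl(\tfrac{p_3-p_2}{2},\tfrac{\sqrt3}{2}p_1\bigr)$. Then there is a function $h:[-\tfrac12,\tfrac12]\to[0,\tfrac{\sqrt3}{2}]$, Lipschitz with constant at most $\sqrt3$, whose graph lies in (the image of) $\mathcal T$, such that for $p\in\mathcal T$ with image $(x,y)$: if $0<y<h(x)$ then $p\in\mathcal G$, and if $y>h(x)$ then $p\notin\mathcal G$. Moreover, every point $p$ of the graph of $h$ that does not lie on the boundary of the triangle $\mathcal T$ satisfies $p_2>p_c$ and $p_3>p_c$.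
   Context: Let $\mathcal L=2\mathbb Z^3\cup(2\mathbb Z^3+(1,1,1))$, made a graph by declaring $v,w\in\mathcal L$ adjacent iff $v-w\in\{(\pm2,0,0),(0,\pm2,0),(0,0,\pm2)\}$ or $v-w\in\{(\pm1,\pm1,\pm1)\}$ (the body centered cubic lattice). Elements of $\mathcal L$ index the cells of the Voronoi tessellation of $\mathcal L$ in $\mathbb R^3$ (by truncated octahedra), adjacency meaning sharing a face. Faces of the tessellation correspond bijectively to pairs of adjacent cells, and edges of the tessellation to triples of mutually adjacent cells; two faces are adjacent if they have a boundary edge in common (i.e. the two pairs are distinct and contained in a common triple of mutually adjacent cells). Let $\mathcal T=\{p\in[0,1]^3:p_1+p_2+p_3=1\}$. For $p\in\mathcal T$, $\mathbb P_p$ is the law of the random coloring in which each cell independently is red, yellow, blue with probability $p_1,p_2,p_3$. A face is green if one of its two incident cells is yellow and the other is blue. The green cluster of a face $f$ is the connected component of $f$ in the adjacency graph restricted to green faces (empty if $f$ is not green). $\mathcal G\subset\mathcal T$ is the set of $p$ for which the probability under $\mathbb P_p$ that the green cluster of a given face has more than $N$ faces does not decay exponentially fast in $N$; that is, $p\notin\mathcal G$ iff there are $C,c>0$ with $\mathbb P_p(|\text{green cluster of }f|>N)\le Ce^{-cN}$ for all $N$ and all faces $f$. The green phase separation curve is the curve in the triangle (drawn with the red corner $(1,0,0)$ at the top and the edge $p_1=0$ at the bottom) that bounds $\mathcal G$ from above. $p_c=p_c(\mathcal L)$ is the critical probability for independent site percolation on the graph $\mathcal L$; the critical percolation lines for yellow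 and blue are $\{p_2=p_c\}$ and $\{p_3=p_c\}$, and a point lies strictly below both iff $p_2>p_c$ and $p_3>p_c$. *)

(* Defs.v *)
From HB Require Import structures.
From Stdlib Require Import Relation_Operators.
From mathcomp Require Import all_boot all_order all_algebra.
From mathcomp Require Import finmap.
From mathcomp Require Import all_classical all_reals all_analysis.
Import numFieldNormedType.Exports.

Set Implicit Arguments.
Unset Strict Implicit.
Unset Printing Implicit Defensive.

Import Order.TTheory GRing.Theory Num.Theory.
Local Open Scope classical_set_scope.
Local Open Scope ring_scope.

Definition cylinder_base (I : Type) (A : pointedType) : set (set (I -> A)) :=
  [set C | exists i a, C = [set x | x i = a]].

Definition config (I : Type) (A : pointedType) :=
  g_sigma_algebraType (@cylinder_base I A).

Definition is_product_law (R : realType) (I : choiceType) (A : pointedType)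
    (w : A -> R) (P : probability (config I A) R) :=
  forall (J : {fset I}) (s : I -> A),
    P [set x | forall i, i \in J -> x i = s i] = (\prod_(i <- J) w (s i))%:E.

(* For I countable and w a probability vector on a finite alphabet A, this is
   the unique product measure; existence is [product_lawP] below, and
   uniqueness holds because the cylinder sets form a generating pi-system. The
   Dirac measure is a junk value for the other w. *)
Definition product_law (R : realType) (I : choiceType) (A : pointedType)
    (w : A -> R) : probability (config I A) R :=
  xget (\d_(point : config I A) : probability (config I A) R)
    [set P | is_product_law w P].

Section product_law_exists.
Variables (R : realType) (k : nat) (v : 'I_k -> R).
Hypotheses (v0 : forall a, 0 <= v a) (v1 : \sum_a v a = 1).

(* The coin-tossing construction: [0, 1[ is cut into consecutive intervals of
   lengths v a, each of which is mapped affinely onto [0, 1[; the digits of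
   the iterates are i.i.d. of law v under the Lebesgue measure. *)
Let C (j : nat) : R := \sum_(b < k | (b < j)%N) v b.

Let C0 : C 0 = 0.
Proof. by rewrite /C big_pred0. Qed.

Let CS (a : 'I_k) : C a.+1 = C a + v a.
Proof.
rewrite /C (bigD1 a) //= addrC; congr (_ + _); apply: eq_bigl => b.
by rewrite ltnS andbC -val_eqE /= ltn_neqAle.
Qed.

Let Ck : C k = 1.
Proof. by rewrite -v1 /C; apply: eq_bigl => b; rewrite ltn_ord. Qed.

Let Cle (i j : nat) : (i <= j)%N -> C i <= C j.
Proof.
move=> ij; rewrite /C [leLHS]big_mkcond [leRHS]big_mkcond /=.
apply: ler_sum => b _; case: ifPn => [bi|_]; first by rewrite (leq_trans bi).
by case: ifP.
Qed.

Let digit (x : R) : option 'I_k := [pick a : 'I_k | C a <= x < C a.+1].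

Let digitP x a : digit x = Some a <-> C a <= x < C a.+1.
Proof.
rewrite /digit; case: pickP => [b /andP[b1 b2]|H]; last by split=> //; rewrite H.
split=> [[<-]|/andP[a1 a2]]; first by rewrite b1.
congr Some; apply/val_inj/eqP; rewrite eqn_leq /=.
apply/andP; split; rewrite leqNgt; apply/negP => h.
- by have := lt_le_trans (lt_le_trans a2 (Cle h)) b1; rewrite ltxx.
- by have := lt_le_trans (lt_le_trans b2 (Cle h)) a1; rewrite ltxx.
Qed.

Let digit_ex x : 0 <= x < 1 -> exists a, digit x = Some a.
Proof.
move=> /andP[x0 x1].
have exC : exists j, x < C j by exists k; rewrite Ck.
case: (ex_minnP exC) => -[|j] xj jmin; first by move: xj; rewrite C0 ltNge x0.
have jk : (j < k)%N by apply: jmin; rewrite Ck.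
exists (Ordinal jk); apply/digitP => /=; rewrite xj andbT leNgt.
by apply/negP => /jmin; rewrite ltnn.
Qed.

Let shift x := if digit x is Some a then (x - C a) / v a else x.

Fixpoint follows (s : seq 'I_k) (x : R) : Prop :=
  if s is a :: s' then digit x = Some a /\ follows s' (shift x)
  else 0 <= x < 1.

Fixpoint left_end (s : seq 'I_k) : R :=
  if s is a :: s' then C a + v a * left_end s' else 0.

Let width (s : seq 'I_k) : R := \prod_(a <- s) v a.

Let width_ge0 s : 0 <= width s.
Proof. by apply: prodr_ge0. Qed.

Let left_end_bound s : 0 <= left_end s /\ left_end s + width s <= 1.
Proof.
elim: s => [|a s [h0 h1]] /=; first by rewrite /width big_nil add0r.
split; first by rewrite addr_ge0 ?mulr_ge0// -C0 Cle.
rewrite /width big_cons -/(width s) -addrA -mulrDr.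
apply: (@le_trans _ _ (C a.+1)); last by rewrite -Ck Cle.
by rewrite CS lerD2l ler_piMr.
Qed.

Let followsP s x : follows s x <-> left_end s <= x < left_end s + width s.
Proof.
elim: s x => [|a s IH] x /=; first by rewrite /width big_nil add0r.
have [l0 l1] := left_end_bound s.
rewrite digitP /width big_cons -/(width s) -addrA -mulrDr.
have E : C a <= x < C a.+1 -> 0 < v a /\ shift x = (x - C a) / v a.
  move=> h; split; last by move/digitP: h; rewrite /shift => ->.
  move: h; rewrite CS => /andP[h1 h2].
  by have := le_lt_trans h1 h2; rewrite ltrDl.
split.
  move=> [/E[va ->]] /IH.
  by rewrite ler_pdivlMr// ltr_pdivrMr// lerBrDl ltrBlDl ![_ * v a]mulrC.
move=> h.
have h' : C a <= x < C a.+1.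
  move: h => /andP[h1 h2]; rewrite (le_trans _ h1) ?lerDl ?mulr_ge0//=.
  by rewrite (lt_le_trans h2)// CS lerD2l ler_piMr.
split=> //; have [va ->] := E h'; apply/IH.
by rewrite ler_pdivlMr// ltr_pdivrMr// lerBrDl ltrBlDl ![_ * v a]mulrC.
Qed.

Let shift01 x : 0 <= x < 1 -> 0 <= shift x < 1.
Proof.
move=> x01; have [a xa] := digit_ex x01.
rewrite /shift xa; move/digitP : xa; rewrite CS => /andP[h1 h2].
have va : 0 < v a by have := le_lt_trans h1 h2; rewrite ltrDl.
by rewrite ler_pdivlMr// ltr_pdivrMr// mul0r mul1r lerBrDl addr0 ltrBlDl h1.
Qed.

Let follows_ex n x : 0 <= x < 1 -> exists2 s, size s = n & follows s x.
Proof.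
elim: n x => [|n IH] x x01; first by exists [::].
have [a xa] := digit_ex x01.
by have [s ss fs] := IH _ (shift01 x01); exists (a :: s); rewrite /= ?ss.
Qed.

Let follows_nth s x : follows s x ->
  forall i (a0 : 'I_k), (i < size s)%N -> digit (iter i shift x) = Some (nth a0 s i).
Proof.
elim: s x => [|a s IH] x //= [xa fs] [|i] a0 //= si.
by rewrite -iterS iterSr (IH _ fs i a0).
Qed.

Variables (A : pointedType) (e : 'I_k -> A).
Hypothesis be : bijective e.

Let X (n : nat) (x : R) : A :=
  if 0 <= x < 1 then (if digit (iter n shift x) is Some a then e a else point)
  else point.

Let D : set R := `[0, 1[%classic.

Let mD : measurable D.
Proof. exact: measurable_itv. Qed.

Let DP x : D x <-> 0 <= x < 1.
Proof. by rewrite /D /= in_itv. Qed.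

Let word n (f : {ffun 'I_n -> 'I_k}) : seq 'I_k := [seq f i | i <- enum 'I_n].

Let size_word n f : size (@word n f) = n.
Proof. by rewrite size_map size_enum_ord. Qed.

Let nth_word n f a0 (i : 'I_n) : nth a0 (@word n f) i = f i.
Proof. by rewrite (nth_map i) ?size_enum_ord// nth_ord_enum. Qed.

Let width_word n f : width (@word n f) = \prod_i v (f i).
Proof. by rewrite /width big_map big_enum. Qed.

Let wordK (s : seq 'I_k) n : size s = n -> exists f, s = @word n f.
Proof.
move=> sn; case: s => [|a s] in sn *.
  by subst n; exists (ffun0 (card_ord 0)); rewrite /word enum_ord0.
exists [ffun i : 'I_n => nth a (a :: s) i].
apply: (@eq_from_nth _ a); first by rewrite size_word.
move=> i; rewrite sn => i_n.
by rewrite -[i]/(val (Ordinal i_n)) nth_word ffunE.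
Qed.

Let itvw n (f : {ffun 'I_n -> 'I_k}) : set R :=
  [set` `[left_end (word f), left_end (word f) + width (word f)[].

Let itvwP n f x : @itvw n f x <-> follows (word f) x.
Proof. by rewrite followsP /itvw /= in_itv. Qed.

Let itvw_D n f : @itvw n f `<=` D.
Proof.
move=> x; rewrite DP /itvw /= in_itv /= => /andP[h1 h2].
have [l0 l1] := left_end_bound (word f).
by rewrite (le_trans l0)//= (lt_le_trans h2).
Qed.

Let itvw_X n f x (i : 'I_n) : @itvw n f x -> X i x = e (f i).
Proof.
move=> fx; have x01 := itvw_D fx; rewrite /X; move/DP : x01 => ->.
move/itvwP : fx => /follows_nth fx.
by rewrite (fx _ (f i)) ?size_word// nth_word.
Qed.

Let itvw_ex n x : D x -> exists f, @itvw n f x.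
Proof.
move=> /DP /(follows_ex n)[s sn fs]; have [f sf] := wordK sn.
by exists f; apply/itvwP; rewrite -sf.
Qed.

Let event n (F : 'I_n -> pred 'I_k) : set R :=
  [set x | D x /\ forall i : 'I_n, exists2 a, X i x = e a & F i a].

Let eventE n F : @event n F =
  \bigcup_(f in [set f : {ffun 'I_n -> 'I_k} | f \in family F]) itvw f.
Proof.
have [e' eK _] := be.
apply/seteqP; split => x.
  move=> [xD xF]; have [f xf] := itvw_ex n xD; exists f => //=.
  apply/familyP => i; have [a + Fa] := xF i.
  by rewrite (itvw_X i xf) => /(can_inj eK) ->.
move=> [f /= /familyP fF xf]; split; first exact: (itvw_D xf).
by move=> i; exists (f i); [exact: itvw_X|exact: fF].
Qed.

Let finf n (F : 'I_n -> pred 'I_k) :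
  finite_set [set f : {ffun 'I_n -> 'I_k} | f \in family F].
Proof. exact: finite_finset. Qed.

Let measurable_event n F : measurable (@event n F).
Proof.
by rewrite eventE; apply: fin_bigcup_measurable => // f _; exact: measurable_itv.
Qed.

Let mu : set R -> \bar R := mrestr (@lebesgue_measure R) mD.

Let event_law n F :
  mu (@event n F) = (\prod_i \sum_(a | F i a) v a)%:E.
Proof.
have [e' eK _] := be.
rewrite /mu/= /mrestr setIidl; last by move=> x [].
rewrite eventE measure_fin_bigcup//; last 2 first.
- move=> f g _ _ [x [xf xg]]; apply/ffunP => i.
  by apply: (can_inj eK); rewrite -(itvw_X i xf) (itvw_X i xg).
- by move=> f _; exact: measurable_itv.
rewrite bigA_distr_big_dep -(@bigfs _ _ _ _ (index_enum _)) ?index_enum_uniq//; last first.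
  by move=> f _; rewrite mem_index_enum.
rewrite -sumEFin; apply: eq_bigr => f _.
transitivity (@lebesgue_measure R (itvw f)); first by [].
rewrite /itvw lebesgue_measure_itv /= lte_fin ltrDl -width_word.
case: ltgtP (width_ge0 (word f)) => // [_|<-] _ //.
by rewrite -EFinD addrAC subrr add0r.
Qed.

Variable I : countType.

Let Phi (x : measurableTypeR R) : config I A := fun i => X (choice.pickle i) x.

Let measurable_Phi : measurable_fun setT Phi.
Proof.
have [e' eK e'K] := be.
apply: (@measurability _ _ _ (config I A) setT Phi (@cylinder_base I A)) => //.
move=> _ [_ [i [a ->]]] <-; rewrite setTI.
set n := choice.pickle i.
pose F (j : 'I_n.+1) : pred 'I_k := fun b => (j == ord_max) ==> (e b == a).
have -> : Phi @^-1` [set x | x i = a] =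
    @event n.+1 F `|` (if a == point then ~` D else set0).
  apply/seteqP; split => x.
    rewrite /Phi /= -/n => Xa; have [xD|xD] := pselect (D x).
      left; split => // j; have [f xf] := itvw_ex n.+1 xD.
      exists (f j); first exact: itvw_X.
      apply/implyP => /eqP jn; rewrite -(itvw_X j xf) jn /=.
      exact/eqP.
    right; move: Xa; rewrite /X; case: ifP => [/DP//|_] <-.
    by rewrite eqxx.
  rewrite /Phi /= -/n => -[[xD xF]|].
    have [b Xb] := xF ord_max.
    by rewrite /F eqxx => /eqP <-.
  by case: eqP => [->|_ []] xD; rewrite /X; case: ifP.
apply: measurableU; first exact: measurable_event.
by case: ifP => // _; exact: measurableC.
Qed.

#[local] HB.instance Definition _ := isMeasurableFun.Build _ _ _ (config I A) Phi measurable_Phi.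

Let muT : mrestr (@lebesgue_measure R) mD setT = 1%E.
Proof.
rewrite /mrestr setTI.
by rewrite lebesgue_measure_itv /= lte_fin ltr01 oppr0 adde0.
Qed.

#[local] HB.instance Definition _ := Measure_isProbability.Build _ _ _
  (mrestr (@lebesgue_measure R) mD) muT.

Let law : probability (config I A) R :=
  distribution (mrestr (@lebesgue_measure R) mD) Phi.

Let law_product (w : A -> R) (J : {fset I}) (s : I -> A) : (forall a, w (e a) = v a) ->
  law [set x | forall i, i \in J -> x i = s i] = (\prod_(i <- J) w (s i))%:E.
Proof.
move=> wv; have [e' eK e'K] := be.
set n := (\max_(i <- J) (choice.pickle i)).+1.
have Jn i : i \in J -> (choice.pickle i < n)%N.
  by move=> iJ; rewrite ltnS (big_rem i)//= leq_maxl.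
clearbody n.
pose F (j : nat) : pred 'I_k := fun b =>
  if @pickle_inv I j is Some i then (i \in J) ==> (e b == s i) else true.
pose G (j : nat) : R := if @pickle_inv I j is Some i then
  (if i \in J then w (s i) else 1) else 1.
transitivity (mu (@event n F)).
  rewrite /law /= /distribution /pushforward /mu /= /mrestr; congr lebesgue_measure.
  apply/seteqP; split => x /=.
    move=> [xs xD]; split; last by [].
    split=> // j; have [f xf] := itvw_ex n xD.
    exists (f j); first exact: itvw_X.
    rewrite /F; case E : (@pickle_inv I j) => [i|//].
    apply/implyP => iJ; rewrite -(itvw_X j xf) -(xs _ iJ) /Phi.
    by have := @pickle_invK I j; rewrite E /= => ->.
  move=> [[xD xs] _]; split=> // i iJ.
  have [b] := xs (Ordinal (Jn _ iJ)).
  by rewrite /F /= pickleK_inv iJ /= /Phi => -> /eqP.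
rewrite event_law; congr EFin.
transitivity (\prod_(j < n) G j).
  apply: eq_bigr => j _; rewrite /F /G.
  case: (@pickle_inv I j) => [i|]; last by rewrite -v1; apply: eq_bigl.
  case: (i \in J) => /=; last by rewrite -v1; apply: eq_bigl.
  rewrite (big_pred1 (e' (s i))); first by rewrite -wv e'K.
  by move=> b /=; rewrite -(can_eq e'K) /= eK.
rewrite -(big_mkord xpredT G) (bigID (fun j => j \in [seq choice.pickle i | i <- J])) /=.
rewrite [X in _ * X]big1 ?mulr1; last first.
  move=> j /negP jJ; rewrite /G; case E : (@pickle_inv I j) => [i|//].
  case: ifP => // iJ; exfalso; apply: jJ; apply/mapP; exists i => //.
  by have := @pickle_invK I j; rewrite E.
rewrite -big_filter (perm_big [seq choice.pickle i | i <- J]).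
  rewrite big_map big_seq [RHS]big_seq; apply: eq_bigr => i iJ.
  by rewrite /G pickleK_inv iJ.
apply: uniq_perm; first exact/filter_uniq/iota_uniq.
  by rewrite map_inj_uniq ?fset_uniq//; exact: (pcan_inj choice.pickleK).
move=> j; rewrite mem_filter mem_index_iota /= andbC.
by case: (boolP (j \in _)) => [/mapP[i iJ ->]|]; rewrite ?andbT ?andbF ?Jn.
Qed.

Lemma product_law_exists (w : A -> R) : (forall a, w (e a) = v a) ->
  exists P : probability (config I A) R, is_product_law w P.
Proof. by move=> wv; exists law => J s; exact: law_product. Qed.

End product_law_exists.

Lemma product_lawP (R : realType) (I : countType) (A : pointedType) (w : A -> R)
    (k : nat) (e : 'I_k -> A) :
  bijective e -> (forall a, 0 <= w a) -> \sum_(j < k) w (e j) = 1 ->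
  is_product_law w (@product_law R I A w).
Proof.
move=> be w0 w1; rewrite /product_law.
exact/(@xgetPex _ _ [set P | is_product_law w P])/
  (@product_law_exists _ _ (w \o e) (fun j => w0 (e j)) w1 _ _ be).
Qed.

Definition in_bcc (v : int * int * int) : bool :=
  let: (x, y, z) := v in
  [&& (2 %| x)%Z, (2 %| y)%Z & (2 %| z)%Z] ||
  [&& (2 %| x - 1)%Z, (2 %| y - 1)%Z & (2 %| z - 1)%Z].

Definition cell : countType := {v : int * int * int | in_bcc v}.

Definition origin : cell := exist in_bcc (0, 0, 0) isT.

Definition bcc_adjacent (v w : cell) : Prop :=
  val v - val w \in
    ([:: (2, 0, 0); (-2, 0, 0); (0, 2, 0); (0, -2, 0); (0, 0, 2); (0, 0, -2);
         (1, 1, 1); (1, 1, -1); (1, -1, 1); (1, -1, -1);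
         (-1, 1, 1); (-1, 1, -1); (-1, -1, 1); (-1, -1, -1)]
      : seq (int * int * int)).

(* A face of the tessellation is encoded as the pair {v, w} of cells that it
   separates. *)
Definition is_face (f : {fset cell}) : Prop :=
  exists v w, bcc_adjacent v w /\ f = [fset v; w]%fset.

Definition faces_adjacent (f g : {fset cell}) : Prop :=
  [/\ is_face f, is_face g, f <> g &
    exists u v w, [/\ bcc_adjacent u v, bcc_adjacent v w, bcc_adjacent u w,
      (f `<=` [fset u; v; w])%fset & (g `<=` [fset u; v; w])%fset]].

(* The connected component of x in the subgraph induced on S, empty if x is
   not in S. *)
Definition graph_component (V : Type) (e : V -> V -> Prop) (S : set V) (x : V) : set V :=
  [set y | S x /\ clos_refl_trans V (fun a b => [/\ S a, S b & e a b]) x y].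

Inductive color := red | yellow | blue.

HB.instance Definition _ := gen_eqMixin color.
HB.instance Definition _ := gen_choiceMixin color.
HB.instance Definition _ := isPointed.Build color red.

Section model.
Variable R : realType.

(* The coordinates (p_1, p_2, p_3) are p red, p yellow and p blue. *)
Definition triangle : set (color -> R) :=
  [set p | (forall c, 0 <= p c <= 1) /\ p red + p yellow + p blue = 1].

Definition triangle_boundary : set (color -> R) :=
  [set p | triangle p /\ exists c, p c = 0].

Definition plane_x (p : color -> R) : R := (p blue - p yellow) / 2.
Definition plane_y (p : color -> R) : R := Num.sqrt 3 / 2 * p red.

Definition color_law (p : color -> R) : probability (config cell color) R :=
  product_law cell p.

Lemma color_lawP p : triangle p -> is_product_law p (color_law p).
Proof.
move=> [p0 p1].
pose e (j : 'I_3) := nth blue [:: red; yellow; blue] j.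
apply: (@product_lawP _ _ _ _ 3 e).
- exists (fun c : color => match c with
    red => @Ordinal 3 0 isT | yellow => @Ordinal 3 1 isT
  | blue => @Ordinal 3 2 isT end).
    by case=> -[|[|[|]]] //= i; apply/val_inj.
  by case.
- by move=> c; have /andP[] := p0 c.
- by rewrite !big_ord_recr big_ord0 /= add0r.
Qed.

Definition green (x : config cell color) : set {fset cell} :=
  [set f | exists v w,
    [/\ bcc_adjacent v w, f = [fset v; w]%fset, x v = yellow & x w = blue]].

Definition green_cluster (x : config cell color) (f : {fset cell}) :
    set {fset cell} :=
  graph_component faces_adjacent (green x) f.

(* `I_N.+1 #<= K says that K has more than N elements. The event depends on the
   colors of finitely many cells only, hence is measurable. *)
Definition green_exp_decay (p : color -> R) : Prop :=
  exists C c : R, [/\ 0 < C, 0 < c & forall (N : nat) f, is_face f ->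
    (color_law p [set x | (`I_N.+1 #<= green_cluster x f)%card]
       <= (C * expR (- c * N%:R))%:E)%E].

Definition green_phase : set (color -> R) :=
  [set p | triangle p /\ ~ green_exp_decay p].

Definition site_law (q : R) : probability (config cell bool) R :=
  product_law cell (fun b : bool => if b then q else 1 - q).

Lemma site_lawP q : 0 <= q <= 1 ->
  is_product_law (fun b : bool => if b then q else 1 - q) (site_law q).
Proof.
move=> /andP[q0 q1]; pose e (j : 'I_2) := (j == 1 :> nat).
apply: (@product_lawP _ _ _ _ 2 e).
- exists (fun b : bool => if b then @Ordinal 2 1 isT else @Ordinal 2 0 isT).
    by case=> -[|[|]] //= i; apply/val_inj.
  by case.
- by case=> //; rewrite subr_ge0.
- by rewrite !big_ord_recr big_ord0 /= add0r subrK.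
Qed.

Definition open_cluster (x : config cell bool) (v : cell) : set cell :=
  graph_component bcc_adjacent [set w | x w] v.

Definition percolation_proba (q : R) : \bar R :=
  site_law q [set x | infinite_set (open_cluster x origin)].

(* The set contains 0 and is bounded by 1. *)
Definition p_c : R := sup [set q | 0 <= q <= 1 /\ percolation_proba q = 0%E].

End model.

Arguments p_c : clear implicits.

(* Main.v *)
(* Recoloring red cells yellow or blue can only create green faces. In the plane,
   moving weight from red to yellow and blue spans a downward cone with sides of
   slope sqrt 3, so G is the region below the graph of a Lipschitz function.

   For the strict inequality, the yellow cells of a green cluster form a connected
   set of yellow cells each of which has a blue neighbour. Given which cells are
   yellow, the other cells are blue independently with probability beta < 1; the
   bit "w is blue" lies below the conjunction of independent bits b(w, v), one for
   each of the 14 neighbours v of w, as soon as these have parameter b with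
   b ^ 14 >= beta. Hence the yellow cells with a blue neighbour are dominated by
   the yellow cells v with b(w, v) = 1 for some w, that is by independent site
   percolation of parameter p2 (1 - (1 - b) ^ 14), which is strictly smaller than
   p2. So p2 can exceed p_c slightly while this percolation remains subcritical.

   In subcritical percolation the size of a cluster has an exponential moment: the
   argument of Duminil-Copin and Tassion yields a finite set S around the origin
   such that the expected number of boundary vertices of S adjacent to the cluster
   of the origin in S is less than 1, and exploring a cluster by successive
   translates of S compares it with a subcritical branching process. *)
Require Import Defs.
From Stdlib Require Import Relation_Operators Operators_Properties.
From mathcomp Require Import all_boot all_order all_algebra.
From mathcomp Require Import finmap.
From mathcomp Require Import all_classical all_reals all_analysis.
From mathcomp Require Import ring lra zify.
Import numFieldNormedType.Exports.

Set Implicit Arguments.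
Unset Strict Implicit.
Unset Printing Implicit Defensive.

Import Order.TTheory GRing.Theory Num.Theory.
Local Open Scope classical_set_scope.
Local Open Scope ring_scope.

(** * Expectations over finitely many independent sites *)

Definition upd (V : eqType) (A : Type) (x : V -> A) (v : V) (a : A) : V -> A :=
  fun u => if u == v then a else x u.

Definition dep_on (V A T : Type) (D : set V) (f : (V -> A) -> T) : Prop :=
  forall x y, (forall v, D v -> x v = y v) -> f x = f y.

Section update.
Variables (V : eqType) (A T : Type).
Implicit Types (x : V -> A) (D : set V) (f : (V -> A) -> T).

Lemma updC x v w a b : v != w -> upd (upd x v a) w b = upd (upd x w b) v a.
Proof.
move=> vw; apply/funext => u; rewrite /upd.
by case: (eqVneq u w) => // ->; case: (eqVneq w v) vw => // ->; rewrite eqxx.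
Qed.

Lemma dep_on_sub D D' f : D `<=` D' -> dep_on D f -> dep_on D' f.
Proof. by move=> DD' Df x y xy; apply: Df => v /DD'/xy. Qed.

Lemma dep_on_upd v a D f : dep_on D f -> dep_on (D `\ v) (fun x => f (upd x v a)).
Proof.
move=> Df x y xy; apply: Df => u Du; rewrite /upd.
by case: eqVneq => // /eqP uv; exact: xy.
Qed.

Lemma dep_on_updid D f v a x : dep_on D f -> ~ D v -> f (upd x v a) = f x.
Proof.
move=> Df Dv; apply: Df => u Du; rewrite /upd.
by case: eqVneq => // uv; case: Dv; rewrite -uv.
Qed.

End update.

Section expectation.
Variables (R : realType) (V : choiceType) (A : pointedType) (al : seq A).
Implicit Types (w : V -> A -> R) (s t : seq V) (f g : (V -> A) -> R).

(* The sites outside s carry the default value [point]. *)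
Fixpoint expect w s f : R :=
  if s is v :: s' then \sum_(a <- al) w v a * expect w s' (fun x => f (upd x v a))
  else f (fun=> point).

Lemma eq_expect w s f g : f =1 g -> expect w s f = expect w s g.
Proof. by move=> /funext ->. Qed.

Lemma expect_linear w s (k : R) f g :
  expect w s (fun x => k * f x + g x) = k * expect w s f + expect w s g.
Proof.
elim: s f g => //= v s IH f g.
rewrite big_distrr -big_split /=; apply: eq_bigr => a _.
by rewrite IH mulrDr mulrCA.
Qed.

Lemma expect0 w s : expect w s (fun=> 0) = 0.
Proof.
have := expect_linear w s 1 (fun=> 0) (fun=> 0).
under eq_expect do rewrite mulr0 addr0.
lra.
Qed.

Lemma expectZ w s (k : R) f : expect w s (fun x => k * f x) = k * expect w s f.
Proof.
have := expect_linear w s k f (fun=> 0); rewrite expect0 addr0 => <-.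
by apply: eq_expect => x; rewrite addr0.
Qed.

Lemma expectD w s f g : expect w s (fun x => f x + g x) = expect w s f + expect w s g.
Proof.
have := expect_linear w s 1 f g; rewrite mul1r => <-.
by apply: eq_expect => x; rewrite mul1r.
Qed.

Lemma expectN w s f : expect w s (fun x => - f x) = - expect w s f.
Proof. by rewrite -mulN1r -expectZ; apply: eq_expect => x; rewrite mulN1r. Qed.

Lemma expectB w s f g : expect w s (fun x => f x - g x) = expect w s f - expect w s g.
Proof.
by rewrite expectD expectN.
Qed.

Lemma expect_sum w s (I : Type) (r : seq I) (P : pred I) (F : I -> (V -> A) -> R) :
  expect w s (fun x => \sum_(i <- r | P i) F i x) = \sum_(i <- r | P i) expect w s (F i).
Proof.
elim: r => [|i r IH].
  under eq_expect do rewrite big_nil.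
  by rewrite big_nil expect0.
rewrite big_cons -IH; case: (boolP (P i)) => Pi; rewrite -?expectD;
  by apply: eq_expect => x; rewrite big_cons ?Pi// (negbTE Pi).
Qed.

Lemma le_expect w s f g : (forall v a, 0 <= w v a) -> (forall x, f x <= g x) ->
  expect w s f <= expect w s g.
Proof.
move=> w0; elim: s f g => //= v s IH f g fg.
by apply: ler_sum => a _; apply: ler_wpM2l => //; exact: IH.
Qed.

Lemma expect_const w s k : (forall v, \sum_(a <- al) w v a = 1) ->
  expect w s (fun=> k) = k.
Proof.
move=> w1; elim: s => //= v s IH; rewrite IH -[RHS]mul1r -(w1 v) big_distrl.
by [].
Qed.

(** Induction on the sites: each site is read by one factor at most, so its sum attaches to that
    factor, while in the other it sums out because the weights add up to 1. *)
Lemma expect_indep w s (D : set V) f g : (forall v, \sum_(a <- al) w v a = 1) ->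
  dep_on D f -> dep_on (~` D) g ->
  expect w s (fun x => f x * g x) = expect w s f * expect w s g.
Proof.
move=> w1; elim: s f g => //= v s IH f g fD gD.
have [Dv|Dv] := pselect (D v).
- have gE a : (fun x => g (upd x v a)) = g.
    by apply/funext => x; apply: dep_on_updid gD _.
  rewrite [X in _ = _ * X](_ : _ = expect w s g); last first.
    under eq_bigr do rewrite gE.
    by rewrite -big_distrl /= w1 mul1r.
  rewrite big_distrl /=; apply: eq_bigr => a _; rewrite -mulrA; congr (_ * _).
  rewrite -IH //; last by apply: (dep_on_sub _ (dep_on_upd a fD)) => u [].
  by apply: eq_expect => x; congr (_ * _); rewrite (dep_on_updid _ _ gD).
- have fE a : (fun x => f (upd x v a)) = f.
    by apply/funext => x; apply: dep_on_updid fD _.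
  rewrite [X in _ = X * _](_ : _ = expect w s f); last first.
    under eq_bigr do rewrite fE.
    by rewrite -big_distrl /= w1 mul1r.
  rewrite big_distrr /=; apply: eq_bigr => a _; rewrite mulrCA; congr (_ * _).
  rewrite -IH //; last by apply: (dep_on_sub _ (dep_on_upd a gD)) => u [].
  by apply: eq_expect => x; congr (_ * _); rewrite (dep_on_updid _ _ fD).
Qed.

Lemma expect_cat w s t f : (forall v, \sum_(a <- al) w v a = 1) ->
  dep_on [set` s] f -> expect w (s ++ t) f = expect w s f.
Proof.
move=> w1; elim: s f => [|v s IH] f fs /=.
  rewrite (_ : f = fun=> f (fun=> point)) ?expect_const//.
  by apply/funext => x; apply: fs.
apply: eq_bigr => a _; rewrite IH//.
apply: (dep_on_sub _ (dep_on_upd a fs)) => u [/=]; rewrite inE.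
by case: eqVneq.
Qed.

Lemma expect_swap w v u s f : v != u ->
  expect w (v :: u :: s) f = expect w (u :: v :: s) f.
Proof.
move=> vu /=; under eq_bigr do rewrite big_distrr.
rewrite exchange_big /=; apply: eq_bigr => b _; rewrite big_distrr.
apply: eq_bigr => a _; rewrite mulrCA; do 2 congr (_ * _).
by apply: eq_expect => x; rewrite updC// eq_sym.
Qed.

Lemma expect_front w v s f : v \in s -> uniq s ->
  expect w s f = expect w (v :: rem v s) f.
Proof.
elim: s f => // u s IH f; rewrite inE /= => vs /andP[us uqs].
case: (eqVneq u v) vs => [->//|uv] /= vs.
rewrite -[RHS]/(expect w [:: v, u & rem v s] f) expect_swap; last by rewrite eq_sym.
  rewrite /=.
by apply: eq_bigr => a _; rewrite IH.
Qed.

Lemma expect_perm w s t f : perm_eq s t -> uniq s -> expect w s f = expect w t f.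
Proof.
elim: s t f => [|v s IH] t f st.
  by move: st; rewrite perm_sym => /perm_nilP ->.
move=> /= /andP[vs us].
have vt : v \in t by rewrite -(perm_mem st) inE eqxx.
have ut : uniq t by rewrite -(perm_uniq st)/= vs.
rewrite (expect_front _ _ vt ut) /=; apply: eq_bigr => a _; congr (_ * _).
apply: IH => //; rewrite -(perm_cons v) (perm_trans st)// perm_to_rem//.
Qed.

(** After a permutation the sites of [s] come first, and the remaining ones, which [f] does not
    read, sum out. Expectations over different finite regions thereby become comparable. *)
Lemma expect_restrict w s t f : (forall v, \sum_(a <- al) w v a = 1) ->
  uniq s -> uniq t -> {subset s <= t} -> dep_on [set` s] f ->
  expect w t f = expect w s f.
Proof.
move=> w1 us ut st fs; rewrite -(expect_cat [seq u <- t | u \notin s] w1 fs).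
apply: expect_perm => //; rewrite uniq_perm// ?cat_uniq ?us ?filter_uniq//=.
  rewrite andbT; apply/hasPn => u; rewrite mem_filter => /andP[]//.
move=> u; rewrite mem_cat mem_filter /=; have := st u.
by case: (u \in s) => //= ->.
Qed.

End expectation.

(** * Bernoulli sites: monotonicity, sitewise operations, Russo's formula *)

Section bernoulli.
Variables (R : realType) (V : choiceType).
Implicit Types (pi rho : V -> R) (s t : seq V) (f g : (V -> bool) -> R).

Definition bernoulli_weight pi (v : V) (b : bool) : R := if b then pi v else 1 - pi v.

Definition bexpect pi s f : R := expect [:: true; false] (bernoulli_weight pi) s f.

Definition increasing f : Prop := forall x y : V -> bool, (forall v, x v -> y v) -> f x <= f y.

Lemma bernoulli_weight_sum pi v : \sum_(a <- [:: true; false]) bernoulli_weight pi v a = 1.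
Proof. by rewrite !big_cons big_nil /bernoulli_weight; ring. Qed.

Lemma bernoulli_weight_ge0 pi : (forall v, 0 <= pi v <= 1) ->
  forall v a, 0 <= bernoulli_weight pi v a.
Proof.
by move=> h v [] /=; rewrite /bernoulli_weight; have /andP[? ?] := h v => //; rewrite subr_ge0.
Qed.

Lemma bexpect_cons pi v s f : bexpect pi (v :: s) f =
  pi v * bexpect pi s (fun x => f (upd x v true)) +
  (1 - pi v) * bexpect pi s (fun x => f (upd x v false)).
Proof. by rewrite /bexpect /= !big_cons big_nil addr0. Qed.

Lemma le_bexpect pi s f g : (forall v, 0 <= pi v <= 1) -> (forall x, f x <= g x) ->
  bexpect pi s f <= bexpect pi s g.
Proof. by move=> h fg; apply: le_expect => //; exact: bernoulli_weight_ge0. Qed.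

Lemma bexpect_indep pi s (D : set V) f g : dep_on D f -> dep_on (~` D) g ->
  bexpect pi s (fun x => f x * g x) = bexpect pi s f * bexpect pi s g.
Proof. by apply: expect_indep; exact: bernoulli_weight_sum. Qed.

Lemma bexpect_const pi s k : bexpect pi s (fun=> k) = k.
Proof. by apply: expect_const; exact: bernoulli_weight_sum. Qed.

Lemma bexpect_restrict pi s t f : uniq s -> uniq t -> {subset s <= t} ->
  dep_on [set` s] f -> bexpect pi t f = bexpect pi s f.
Proof. by apply: expect_restrict; exact: bernoulli_weight_sum. Qed.

Lemma increasing_upd f v b : increasing f -> increasing (fun x => f (upd x v b)).
Proof. by move=> fi x y xy; apply: fi => u; rewrite /upd; case: ifP => // _; exact: xy. Qed.

Lemma increasing_upd_le f v x : increasing f -> f (upd x v false) <= f (upd x v true).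
Proof. by move=> fi; apply: fi => u; rewrite /upd; case: ifP. Qed.

(** Site by site: raising the parameter shifts weight towards the larger of the two conditional
    expectations. *)
Lemma bexpect_mono pi rho s f : increasing f ->
  (forall v, [/\ 0 <= pi v, pi v <= rho v & rho v <= 1]) ->
  bexpect pi s f <= bexpect rho s f.
Proof.
move=> + h; elim: s f => [f _|v s IH f fi]; first by rewrite /bexpect.
rewrite !bexpect_cons.
have h1 := IH _ (increasing_upd v true fi).
have h2 := IH _ (increasing_upd v false fi).
have h3 : bexpect rho s (fun x => f (upd x v false)) <=
          bexpect rho s (fun x => f (upd x v true)).
  apply: le_bexpect => [u|x]; last exact: increasing_upd_le.
  by have [? ? ->] := h u; rewrite andbT; lra.
have [p0 pr r1] := h v; nra.
Qed.

(** The second hypothesis says that [sigma v] is the law of [op] applied to two independent bits at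
    [v]; the first makes the default values agree at sites outside [s]. It is applied to thinning
    ([andb]), to unions ([orb]) and to a coloring built from two bits. *)
Lemma bexpect_op (C : pointedType) (al : seq C) (sigma : V -> C -> R)
    (op : bool -> bool -> C) pi rho s (f : (V -> C) -> R) :
  op false false = point ->
  (forall v (h : C -> R),
    pi v * (rho v * h (op true true) + (1 - rho v) * h (op true false)) +
    (1 - pi v) * (rho v * h (op false true) + (1 - rho v) * h (op false false)) =
    \sum_(c <- al) sigma v c * h c) ->
  bexpect pi s (fun x => bexpect rho s (fun y => f (fun v => op (x v) (y v)))) =
  expect al sigma s f.
Proof.
move=> op0 H; elim: s f => [|v s IH] f.
  by rewrite /bexpect /=; congr f; apply/funext => v; exact: op0.
have E a : bexpect pi s (fun x => bexpect rho (v :: s)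
      (fun y => f (fun u => op (upd x v a u) (y u)))) =
    rho v * expect al sigma s (fun x => f (upd x v (op a true))) +
    (1 - rho v) * expect al sigma s (fun x => f (upd x v (op a false))).
  rewrite -!IH -/(bexpect _ _ _) /bexpect -!expectZ -expectD; apply: eq_expect => x.
  rewrite -/(bexpect _ _ _) bexpect_cons; congr (_ * _ + _ * _);
    by apply: eq_expect => y; congr f; apply/funext => u; rewrite /upd; case: ifP.
by rewrite bexpect_cons !E (H v (fun a => expect al sigma s (fun x => f (upd x v a)))).
Qed.

Lemma russo (s : seq V) f (q : R) : uniq s ->
  is_derive q 1 (fun q => bexpect (fun=> q) s f)
    (\sum_(v <- s) bexpect (fun=> q) s (fun x => f (upd x v true) - f (upd x v false))).
Proof.
elim: s f => [|v s IH] f us.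
  by rewrite big_nil /bexpect /=; exact: is_derive_cst.
have /andP[vs us'] := us.
have h1 := IH (fun x => f (upd x v true)) us'.
have h2 := IH (fun x => f (upd x v false)) us'.
set A := (fun q : R => bexpect (fun=> q) s (fun x => f (upd x v true))) in h1.
set B := (fun q : R => bexpect (fun=> q) s (fun x => f (upd x v false))) in h2.
(* Conditioning on [v] gives q A(q) + (1 - q) B(q). In its derivative, A - B is the term of [v], and
   q A' + (1 - q) B' collects those of the other sites. *)
have -> : (fun q => bexpect (fun=> q) (v :: s) f) = (id * A + (cst 1 - id) * B).
  by apply/funext => r; rewrite bexpect_cons.
apply: is_derive_eq.
rewrite /GRing.scale /= big_cons [X in _ = X + _]bexpect_cons.
have E a : bexpect (fun=> q) s (fun x => f (upd (upd x v a) v true) - f (upd (upd x v a) v false))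
    = A q - B q.
  rewrite /A /B /bexpect -expectB; apply: eq_expect => x.
  have updd b : upd (upd x v a) v b = upd x v b by apply/funext => u; rewrite /upd; case: (u == v).
  by rewrite !updd.
rewrite !E.
have E2 : \sum_(j <- s) bexpect (fun=> q) (v :: s)
      (fun x => f (upd x j true) - f (upd x j false)) =
  q * (\sum_(w <- s) bexpect (fun=> q) s
     (fun x => f (upd (upd x w true) v true) - f (upd (upd x w false) v true))) +
  (1 - q) * (\sum_(w <- s) bexpect (fun=> q) s
     (fun x => f (upd (upd x w true) v false) - f (upd (upd x w false) v false))).
  rewrite !big_distrr -big_split /= big_seq [RHS]big_seq; apply: eq_bigr => u us''.
  have vu : v != u by apply: contraNneq vs => ->.
  by rewrite bexpect_cons; congr (_ * _ + _ * _); apply: eq_expect => x; rewrite !(updC _ _ _ vu).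
rewrite E2 (_ : (cst 1 - id) q = 1 - q) //; ring.
Qed.

End bernoulli.

(** * Clusters and their exploration *)

Section clusters.
Variables (V : choiceType) (nb : V -> seq V).
Hypothesis nbC : forall v w, (w \in nb v) = (v \in nb w).
Implicit Types (U S C : {fset V}) (Z : set V) (x y : V -> bool).

Inductive reach (D Z : set V) : V -> Prop :=
| reach_src v : Z v -> D v -> reach D Z v
| reach_step u v : reach D Z u -> v \in nb u -> D v -> reach D Z v.

Lemma reach_sub D Z : reach D Z `<=` D.
Proof. by move=> v vr; case: vr. Qed.

Lemma reach_mono D Z D' Z' : D `<=` D' -> Z `<=` Z' -> reach D Z `<=` reach D' Z'.
Proof.
move=> DD' ZZ' v; elim=> [u /ZZ' Zu /DD' uD|u w _ uD' wu /DD' wD]; first exact: reach_src.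
exact: reach_step uD' wu wD.
Qed.

Definition open_in U x : set V := [set v | v \in U /\ x v].

(** Several sources are allowed because an exploration keeps a list of pending seeds and the
    sharpness argument starts from a whole boundary. *)
Definition site_cluster U Z x : {fset V} := [fset v in U | `[< reach (open_in U x) Z v >]]%fset.

Lemma clusterP U Z x v : reflect (reach (open_in U x) Z v) (v \in site_cluster U Z x).
Proof.
rewrite !inE /=; apply: (iffP andP) => [[_ /asboolP]//|vr].
by split; [have [] := reach_sub vr|exact/asboolP].
Qed.

Lemma cluster_sub U Z x : (site_cluster U Z x `<=` U)%fset.
Proof. by apply/fsubsetP => v; rewrite !inE => /andP[]. Qed.

Lemma cluster_open U Z x v : v \in site_cluster U Z x -> x v.
Proof. by move=> /clusterP /reach_sub[]. Qed.

Lemma cluster_mono U U' Z Z' x y : (U `<=` U')%fset -> Z `<=` Z' ->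
  (forall v, x v -> y v) -> (site_cluster U Z x `<=` site_cluster U' Z' y)%fset.
Proof.
move=> UU' ZZ' xy; apply/fsubsetP => v /clusterP vr; apply/clusterP.
by apply: reach_mono vr => // u [uU /xy yu]; split=> //; exact: (fsubsetP UU').
Qed.

(* The vertices of U inspected when the cluster of Z in U is found to be C. *)
Definition explored U Z C : {fset V} :=
  [fset v in U | [|| `[< Z v >], v \in C | has (mem C) (nb v)]]%fset.

Lemma in_explored U Z C v :
  (v \in explored U Z C) = (v \in U) && [|| `[< Z v >], v \in C | has (mem C) (nb v)].
Proof. by rewrite !inE. Qed.

Lemma explored_sub U Z C : (explored U Z C `<=` U)%fset.
Proof. by apply/fsubsetP => v; rewrite in_explored => /andP[]. Qed.

Lemma cluster_nb U Z x u v : u \in site_cluster U Z x -> v \in nb u -> v \in U -> x v ->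
  v \in site_cluster U Z x.
Proof.
move=> /clusterP ur uv vU xv; apply/clusterP; exact: reach_step ur uv _.
Qed.

Lemma explored_open U Z x v : v \in explored U Z (site_cluster U Z x) -> x v ->
  v \in site_cluster U Z x.
Proof.
rewrite in_explored => /andP[vU /or3P[/asboolP Zv|//|/hasP[u uv /= uC]]] xv.
  by apply/clusterP; apply: reach_src.
by apply: (cluster_nb uC) => //; rewrite nbC.
Qed.

Lemma explored_src U Z C v : v \in U -> Z v -> v \in explored U Z C.
Proof. by move=> vU Zv; rewrite in_explored vU /=; apply/or3P/Or31/asboolP. Qed.

Lemma explored_nb U Z C u v : u \in C -> v \in nb u -> v \in U -> v \in explored U Z C.
Proof.
move=> uC uv vU; rewrite in_explored vU /=; apply/or3P/Or33/hasP.
by exists u => //; rewrite nbC.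
Qed.

(** The inspected vertices certify the cluster: an open path can only extend it through a source or
    a neighbour of the cluster, both of which have been inspected. *)
Lemma cluster_eq U Z x y :
  (forall v, v \in explored U Z (site_cluster U Z x) -> x v = y v) ->
  site_cluster U Z x = site_cluster U Z y.
Proof.
move=> xy.
have xyC v : v \in site_cluster U Z x -> x v = y v.
  move=> vC; apply: xy; rewrite in_explored vC orbT andbT.
  exact: (fsubsetP (cluster_sub U Z x)).
apply/fsetP => v; apply/idP/idP.
  move=> vC; apply/clusterP; move/clusterP : (vC) => vr.
  elim: vr => [u Zu [uU xu]|u w ur uIH uw [wU xw]].
    apply: reach_src => //; split=> //; rewrite -xyC//.
    by apply/clusterP; apply: reach_src.
  apply: (reach_step uIH) => //; split=> //; rewrite -xyC//.
  by apply/clusterP; apply: reach_step ur _ _.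
move=> /clusterP; elim=> [u Zu [uU yu]|u w ur uIH uw [wU yw]].
  apply/clusterP; apply: reach_src => //; split=> //.
  by rewrite xy//; exact: explored_src.
apply: (cluster_nb uIH uw) => //.
by rewrite xy//; exact: explored_nb uw _.
Qed.

Lemma cluster_dep U Z C : dep_on [set` explored U Z C] (fun x => site_cluster U Z x == C).
Proof.
move=> x y xy; apply/eqP/eqP => E; subst C.
  by apply/esym/cluster_eq => v; exact: xy.
by apply/esym/cluster_eq => v /xy.
Qed.

Lemma dep_on_cluster U Z : dep_on [set` U] (site_cluster U Z).
Proof.
by move=> x y xy; apply: cluster_eq => v /(fsubsetP (explored_sub _ _ _)) /xy.
Qed.

Definition outer_boundary S : {fset V} :=
  [fset w in flatten [seq nb v | v <- S] | w \notin S]%fset.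

Lemma outer_boundaryP S w :
  reflect (w \notin S /\ exists2 v, v \in S & w \in nb v) (w \in outer_boundary S).
Proof.
rewrite !inE /=; apply: (iffP andP) => [[/flattenP[_ /mapP[v vS ->] wv] wS]|[wS [v vS wv]]].
  by split=> //; exists v.
by split=> //; apply/flattenP; exists (nb v) => //; apply/mapP; exists v.
Qed.

(** The vertices just outside [S] through which the cluster may continue; they become the new seeds
    of the exploration. *)
Definition exits U S C : seq V :=
  [seq w <- outer_boundary S | (w \in U) && has (mem C) (nb w)].

(** One exploration step. A path leaving [C] cannot use an inspected vertex, since an open one would
    belong to [C]; so it leaves [S] through an exit, and what follows is found in the uninspected
    region. *)
Lemma cluster_explore U S z (Z : seq V) x C : z \in S ->
  C = site_cluster (U `&` S)%fset [set z] x ->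
  (site_cluster U [set` z :: Z] x `<=`
    C `|` site_cluster (U `\` explored (U `&` S) [set z] C) [set` exits U S C ++ Z] x)%fset.
Proof.
move=> zS CE; apply/fsubsetP => v /clusterP.
set E := explored _ _ _; set T := (_ `|` _)%fset.
(* By induction on paths it suffices that the right-hand side contains the open seeds and absorbs
   the open neighbours of its members. *)
suff H u : u \in U -> x u -> (u \in z :: Z) \/ (exists2 w, w \in T & u \in nb w) -> u \in T.
  elim=> [u Zu [uU xu]|u w ur uIH uw [wU xw]]; apply: H => //; first by left.
  by right; exists u.
move=> uU xu.
have [uE _|uE] := boolP (u \in E).
  by rewrite in_fsetU CE (explored_open _ xu)// -CE.
have uUE : u \in (U `\` E)%fset by rewrite in_fsetD uE.
have uC' (P : set V) : P u -> u \in site_cluster (U `\` E)%fset P x.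
  by move=> Pu; apply/clusterP; apply: reach_src.
rewrite in_fsetU; case=> [|[w]].
  rewrite inE => /orP[/eqP uz|uZ]; last first.
    by rewrite uC' ?orbT//= mem_cat uZ orbT.
  move: uE; rewrite in_explored in_fsetI uU uz zS /= => /negP[].
  by apply/orP; left; exact/asboolP.
rewrite in_fsetU => /orP[wC|wC] uw; last by rewrite (cluster_nb wC uw) ?orbT.
have has_uC : has (mem C) (nb u) by apply/hasP; exists w => //; rewrite nbC.
have uS : u \notin S.
  by apply/negP => uS; move: uE; rewrite in_explored in_fsetI uU uS has_uC !orbT.
have wS : w \in S.
  by move: wC; rewrite CE => /(fsubsetP (cluster_sub _ _ _)); rewrite in_fsetI => /andP[].
rewrite uC' ?orbT//= mem_cat mem_filter uU has_uC /=.
by apply/orP; left; apply/outer_boundaryP; split=> //; exists w.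
Qed.

End clusters.

Section exploration.
Variables (R : realType) (V : choiceType).

(* The domain Markov property: given X = C, the variables outside D C are still
   independent with their original laws. *)
Lemma le_bexpect_explore (pi : V -> R) (s : seq V) (X : (V -> bool) -> {fset V}) (W : {fset V})
    (D : {fset V} -> set V) (H : {fset V} -> (V -> bool) -> R) (c : {fset V} -> R) :
  (forall v, 0 <= pi v <= 1) ->
  (forall x, (X x `<=` W)%fset) ->
  (forall C, dep_on (D C) (fun x => X x == C)) ->
  (forall C, dep_on (~` D C) (H C)) ->
  (forall C, (C `<=` W)%fset -> bexpect pi s (H C) <= c C) ->
  bexpect pi s (fun x => H (X x) x) <= bexpect pi s (fun x => c (X x)).
Proof.
move=> pi01 XW XD HD Hc.
have E (F : {fset V} -> (V -> bool) -> R) x :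
    F (X x) x = \sum_(C <- fpowerset W) (X x == C)%:R * F C x.
  rewrite (bigD1_seq (X x)) ?fset_uniq ?fpowersetE//= eqxx mul1r big1 ?addr0// => C.
  by rewrite eq_sym => /negbTE ->; rewrite mul0r.
have XD' C : dep_on (D C) (fun x => (X x == C)%:R : R).
  by move=> x y xy; rewrite (XD _ _ _ xy).
rewrite /bexpect (eq_expect _ _ _ (E H)) (eq_expect _ _ _ (E (fun C _ => c C))) !expect_sum.
rewrite big_seq [leRHS]big_seq; apply: ler_sum => C; rewrite fpowersetE => CW.
rewrite -!/(bexpect _ _ _) (bexpect_indep _ _ (XD' C) (HD C)).
rewrite (bexpect_indep pi s (XD' C) (_ : dep_on _ (fun=> c C)))//.
rewrite bexpect_const ler_wpM2l ?Hc//.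
rewrite -(bexpect_const pi s 0); apply: le_bexpect => // x; exact: ler0n.
Qed.

End exploration.

(** * Exponential moments of cluster sizes *)

Lemma exists_root_gt1 (R : realType) (B : nat) (c : R) : 1 < c ->
  exists2 k : R, 1 < k & k ^+ B <= c.
Proof.
move=> c1; have c0 : 0 < c by apply: lt_trans c1.
have l0 : 0 < ln c / B.+1%:R by rewrite divr_gt0 ?ln_gt0.
(* A root of order [B] + 1 covers the case [B] = 0 too. *)
exists (expR (ln c / B.+1%:R)); first by rewrite expR_gt1.
apply: (@le_trans _ _ (expR (ln c / B.+1%:R) ^+ B.+1)).
  by apply: ler_weXn2l => //; rewrite ltW ?expR_gt1.
by rewrite -expRM_natl mulrC divfK ?lnK.
Qed.

(** First [K] is taken so close to 1 that rho K^B2 <= r' < 1, where r' = 2 rho / (1 + rho). Then 1 +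
    r' (K - 1) < K, and the remaining room is given to [tau]. *)
Lemma exists_subcritical_moments (R : realType) (B1 B2 : nat) (rho : R) : 0 <= rho < 1 ->
  exists tau K : R, [/\ 1 < tau, 1 < K & tau ^+ B1 * (1 + rho * ((K - 1) * K ^+ B2)) <= K].
Proof.
move=> /andP[r0 r1].
have c1 : 1 < 2 / (1 + rho) by rewrite ltr_pdivlMr; lra.
have [K K1 Kc] := exists_root_gt1 B2 c1.
pose r' := rho * (2 / (1 + rho)).
have r'1 : r' < 1 by rewrite /r' mulrA ltr_pdivrMr; lra.
have r'0 : 0 <= r' by rewrite mulr_ge0// ltW// (lt_trans _ c1).
have d0 : 0 < 1 + r' * (K - 1) by rewrite ltr_wpDr// mulr_ge0//; lra.
have c2 : 1 < K / (1 + r' * (K - 1)) by rewrite ltr_pdivlMr//; nra.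
have [tau tau1 tauc] := exists_root_gt1 B1 c2.
exists tau, K; split=> //.
apply: (@le_trans _ _ (K / (1 + r' * (K - 1)) * (1 + r' * (K - 1)))); last first.
  by rewrite divfK// gt_eqF.
apply: ler_pM => //; first by rewrite exprn_ge0//; lra.
  by rewrite addr_ge0// !mulr_ge0// ?exprn_ge0//; lra.
rewrite lerD2l /r' -mulrA ler_wpM2l// mulrC ler_wpM2r//; lra.
Qed.

(** Linearizes K^k, so that the mean number of exits is enough to control the exponential moment. *)
Lemma exprn_le_linear (R : realDomainType) (K : R) (k B : nat) : 1 <= K -> (k <= B)%N ->
  K ^+ k <= 1 + k%:R * ((K - 1) * K ^+ B).
Proof.
move=> K1; elim: k => [|k IH] kB; first by rewrite expr0 mul0r addr0.
have h := IH (ltnW kB).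
have : K ^+ k <= K ^+ B by rewrite ler_weXn2l// ltnW.
rewrite exprS -natr1 => h2.
have := ler_wpM2l (_ : 0 <= K - 1) h2; rewrite subr_ge0 => /(_ K1).
nra.
Qed.

Section volume.
Variables (R : realType) (V : choiceType) (nb : V -> seq V).
Hypothesis nbC : forall v w, (w \in nb v) = (v \in nb w).
Variable (pi : V -> R).
Hypothesis pi01 : forall v, 0 <= pi v <= 1.
Implicit Types (U S C L : {fset V}) (Z : seq V).

Local Notation site_cluster := (site_cluster nb).

Lemma cluster_nil U x : site_cluster U [set` [::]] x = fset0.
Proof.
apply/eqP; rewrite -fsubset0; apply/fsubsetP => v /clusterP; elim=> //.
Qed.

Lemma cluster_cons_notin U z Z x : z \notin U ->
  (site_cluster U [set` z :: Z] x `<=` site_cluster U [set` Z] x)%fset.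
Proof.
move=> zU; apply/fsubsetP => v /clusterP vr; apply/clusterP.
elim: vr => [u + [uU xu]|u w _ uIH uw [wU xw]]; last exact: reach_step uIH uw _.
rewrite /= inE => /orP[/eqP uz|uZ]; first by rewrite -uz uU in zU.
exact: reach_src.
Qed.

(** The quantity tau^(cells found) K^(pending seeds) behaves as a supermartingale: by the last
    hypothesis, replacing a seed by its exits does not increase the mean. The bound is asked for
    every [U] in [U0] because each step leaves a smaller region. *)
Lemma exploration_volume (L : seq V) (U0 : {fset V}) (S : V -> {fset V}) (tau K : R) : 1 <= tau -> 1 <= K ->
  (forall z, z \in S z) ->
  (forall U z, (U `<=` U0)%fset -> z \in U ->
    bexpect pi L (fun x => let C := site_cluster (U `&` S z)%fset [set z] x in
      tau ^+ #|` C| * K ^+ size (exits nb U (S z) C)) <= K) ->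
  forall U Z, (U `<=` U0)%fset ->
    bexpect pi L (fun x => tau ^+ #|` site_cluster U [set` Z] x|) <= K ^+ size Z.
Proof.
move=> t1 K1 zS HK U; move: {2}#|`U|.+1 (ltnSn #|`U|) => n.
elim: n U => // n IH U Un Z UL.
elim: Z => [|z Z IHZ].
  rewrite expr0 -[leRHS](bexpect_const pi L); apply: le_bexpect => // x.
  by rewrite cluster_nil cardfs0 expr0.
have [zU|zU] := boolP (z \in U); last first.
  apply: (@le_trans _ _ (K ^+ size Z)); last by rewrite ler_weXn2l.
  apply: le_trans IHZ; apply: le_bexpect => // x.
  by rewrite ler_weXn2l// fsubset_leq_card// cluster_cons_notin.
set W := (U `&` S z)%fset.
pose X x := site_cluster W [set z] x.
pose U' C := (U `\` explored nb W [set z] C)%fset.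
pose H C x := tau ^+ #|` C| * tau ^+ #|` site_cluster (U' C) [set` exits nb U (S z) C ++ Z] x|.
pose c C := K ^+ size Z * (tau ^+ #|` C| * K ^+ size (exits nb U (S z) C)).
have zW : z \in W by rewrite in_fsetI zU zS.
apply: (@le_trans _ _ (bexpect pi L (fun x => H (X x) x))).
  apply: le_bexpect => // x; rewrite /H -exprD ler_weXn2l//.
  apply: leq_trans (fsubset_leq_card (cluster_explore nbC Z (zS z) erefl)) _.
  by rewrite cardfsU leq_subr.
apply: (@le_trans _ _ (bexpect pi L (fun x => c (X x)))).
  apply: (le_bexpect_explore (W := W) (D := fun C => [set` explored nb W [set z] C])) => //.
  - by move=> x; exact: cluster_sub.
  - by move=> C; exact: cluster_dep.
  - move=> C x y xy; rewrite /H; congr (_ * _ ^+ #|` _|); apply: (dep_on_cluster nbC) => v /=.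
    by rewrite in_fsetD => /andP[/negP ? _]; exact: xy.
  - move=> C CW; rewrite /H /bexpect expectZ -/(bexpect _ _ _) /c mulrCA.
    rewrite ler_wpM2l ?exprn_ge0 ?(le_trans ler01)//.
    rewrite mulrC -exprD -size_cat; apply: IH.
      (* The seed [z] has itself been inspected, so the region strictly shrinks. *)
      rewrite -ltnS; apply: leq_trans Un; rewrite ltnS.
      apply: fproper_ltn_card; rewrite fproperE fsubsetDl /=; apply/fsubsetPn.
      by exists z => //; rewrite in_fsetD explored_src.
    by apply: fsubset_trans UL; exact: fsubsetDl.
rewrite /c /bexpect expectZ -/(bexpect _ _ _) exprSr ler_wpM2l ?exprn_ge0 ?(le_trans ler01)//.
exact: HK.
Qed.

(* phi_p(S) in the notation of Duminil-Copin and Tassion. *)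
Definition escape S z : R :=
  \sum_(w <- outer_boundary nb S)
    bexpect pi S (fun x => (has (mem (site_cluster S [set z] x)) (nb w))%:R).

(** Restricting to [U] only shrinks the cluster, so its exits are counted by [N], the number of
    boundary vertices adjacent to the cluster in the whole of [S]. The mean of [N] is
    [escape S z]. *)
Lemma exit_moment L U S z (tau K rho : R) (B1 B2 : nat) : 1 <= tau -> 1 <= K ->
  (S `<=` L)%fset -> (#|` S| <= B1)%N -> (#|` outer_boundary nb S| <= B2)%N ->
  escape S z <= rho -> tau ^+ B1 * (1 + rho * ((K - 1) * K ^+ B2)) <= K ->
  bexpect pi L (fun x => let C := site_cluster (U `&` S)%fset [set z] x in
      tau ^+ #|` C| * K ^+ size (exits nb U S C)) <= K.
Proof.
move=> t1 K1 SL SB1 SB2 phi tK; apply: le_trans tK.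
pose N x : R := \sum_(w <- outer_boundary nb S) (has (mem (site_cluster S [set z] x)) (nb w))%:R.
pose G x := tau ^+ B1 * (1 + ((K - 1) * K ^+ B2) * N x).
have t0 k : 0 <= tau ^+ k by rewrite exprn_ge0// (le_trans ler01).
have K0 k : 0 <= K ^+ k by rewrite exprn_ge0// (le_trans ler01).
have k0 : 0 <= (K - 1) * K ^+ B2 by rewrite mulr_ge0// subr_ge0.
apply: (@le_trans _ _ (bexpect pi L G)).
  apply: le_bexpect => // x /=; apply: ler_pM => //.
    rewrite ler_weXn2l//; apply: leq_trans SB1; apply: fsubset_leq_card.
    by apply: fsubset_trans (cluster_sub _ _ _ _) _; exact: fsubsetIr.
  set e := exits _ _ _ _.
  have eB : (size e <= #|` outer_boundary nb S|)%N by rewrite size_filter count_size.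
  apply: le_trans (exprn_le_linear K1 (leq_trans eB SB2)) _.
  rewrite lerD2l mulrC ler_wpM2l// /N /e /exits size_filter -sum1_count natr_sum big_mkcond /=.
  apply: ler_sum => w _; case: ifP => // /andP[_ /hasP[u uw uC]].
  rewrite (_ : has _ _)//; apply/hasP; exists u => //=.
  move: uC => /=; apply: fsubsetP; apply: cluster_mono => //; exact: fsubsetIr.
rewrite /bexpect expectZ -/(bexpect _ _ _) ler_wpM2l//.
rewrite /bexpect expectD expectZ -!/(bexpect _ _ _) bexpect_const lerD2l mulrC ler_wpM2r//.
apply: le_trans phi; rewrite /N /bexpect expect_sum; apply: ler_sum => w _.
rewrite -/(bexpect _ _ _) (@bexpect_restrict _ _ pi S L)//; first exact: fsubsetP.
by move=> x y xy; rewrite (dep_on_cluster nbC [set _] xy).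
Qed.

Theorem cluster_exp_moment (S : V -> {fset V}) (rho : R) (B1 B2 : nat) : rho < 1 ->
  (forall z, [/\ z \in S z, (#|` S z| <= B1)%N, (#|` outer_boundary nb (S z)| <= B2)%N
               & escape (S z) z <= rho]) ->
  exists tau K : R, [/\ 1 < tau, 1 < K & forall U Z,
    bexpect pi U (fun x => tau ^+ #|` site_cluster U [set` Z] x|) <= K ^+ size Z].
Proof.
move=> r1 HS.
(* The maximum with 0 is taken because no sign is assumed for [rho]. *)
have [|tau [K [t1 K1 tK]]] := @exists_subcritical_moments R B1 B2 (Num.max rho 0).
  by rewrite le_max lexx orbT /= gt_max r1 ltr01.
exists tau, K; split=> // U Z.
(* Enlarged so as to contain every [S z] that the exploration of [U] can use. *)
pose L := (U `|` \bigcup_(z <- U) S z)%fset.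
have UL : (U `<=` L)%fset by exact: fsubsetUl.
rewrite -(@bexpect_restrict _ _ pi U L)//; last 2 first.
- exact: fsubsetP.
- by move=> x y xy; rewrite (dep_on_cluster nbC _ xy).
apply: (exploration_volume (U0 := U) (S := S)) => //; rewrite ?(ltW t1) ?(ltW K1)//.
  by move=> z; have [] := HS z.
move=> W z WU zW; have [zS SB1 SB2 phi] := HS z.
apply: (@exit_moment L W (S z) z tau K (Num.max rho 0) B1 B2) => //; rewrite ?(ltW t1) ?(ltW K1)//.
  apply: fsubset_trans (fsubsetUr _ _); apply: bigfcup_sup => //.
  exact: (fsubsetP WU).
by rewrite le_max phi.
Qed.
End volume.

(** * Sharpness *)

Lemma ler_nat_bool (R : numDomainType) (a b : bool) : (a -> b) -> a%:R <= b%:R :> R.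
Proof. by case: a; case: b => // /(_ isT). Qed.

Section sharpness.
Variables (R : realType) (V : choiceType) (nb : V -> seq V).
Hypothesis nbC : forall v w, (w \in nb v) = (v \in nb w).
Variables (L : {fset V}) (o : V).
Hypothesis oL : o \in L.
Implicit Types (x y : V -> bool) (q : R).

Definition inner_boundary : set V := [set v | has (fun w => w \notin L) (nb v)].

(** The union of the open clusters of [L] that touch its boundary. Exploring inwards from the
    boundary leaves the sites around [o] fresh when [o] is not reached. *)
Definition exit_cluster x : {fset V} := site_cluster nb L inner_boundary x.

Definition exit_proba q : R := bexpect (fun=> q) L (fun x => (o \in exit_cluster x)%:R).

(* The region left unexplored by revealing the clusters of the boundary; the
   exploration is surrounded by closed vertices, each of which is pivotal as soon
   as it is adjacent to the cluster of o in this region. *)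
Let unexplored x : {fset V} := (L `\` explored nb L inner_boundary (exit_cluster x))%fset.

Let unexplored_dep (S : {fset V}) : dep_on (~` [set` S]) (fun x => unexplored x == S).
Proof.
have H x y : (forall v, (~` [set` S]) v -> x v = y v) -> unexplored x = S -> unexplored y = S.
  move=> xy xS; rewrite -xS /unexplored /exit_cluster -(cluster_eq nbC (x := x) (y := y))// => v vE.
  by apply: xy => /=; apply/negP; rewrite -xS in_fsetD vE.
move=> x y xy; apply/eqP/eqP; apply: H => // v /xy//.
Qed.

Let unexplored_exit x : o \in unexplored x -> o \notin exit_cluster x.
Proof.
rewrite in_fsetD => /andP[+ _]; apply: contra => oH.
by rewrite in_explored oL oH orbT.
Qed.

(** If [w] were outside [L], its unexplored neighbour would be a boundary source; if it were open,
    it would be in the exit cluster and that neighbour would have been inspected. *)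
Let boundary_closed x w : w \in outer_boundary nb (unexplored x) ->
  w \in explored nb L inner_boundary (exit_cluster x) /\ ~~ x w.
Proof.
move=> /outer_boundaryP[wS [v]]; rewrite in_fsetD in_explored => /andP[+ vL] wv.
rewrite vL negb_or negb_or /= => /and3P[/asboolP vb _ vH].
have wL : w \in L.
  by apply: contra_notT vb => wL; apply/hasP; exists w.
have wE : w \in explored nb L inner_boundary (exit_cluster x).
  by apply: contraNT wS => wE; rewrite in_fsetD wE.
split=> //; apply/negP => xw.
have wH := explored_open nbC wE xw.
by move/hasP : vH; apply; exists w.
Qed.

Let open_explored x w : w \in explored nb L inner_boundary (exit_cluster x) ->
  w \in exit_cluster (upd x w true).
Proof.
have xu v : x v -> upd x w true v by rewrite /upd; case: eqP.
have ww : upd x w true w by rewrite /upd eqxx.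
rewrite in_explored => /andP[wL /or3P[/asboolP wb|wH|/hasP[u uw /= uH]]].
- by apply/clusterP; apply: reach_src.
- by move: wH; apply: fsubsetP; exact: cluster_mono.
- apply: (cluster_nb (u := u)) => //; last by rewrite nbC.
  by move: uH; apply: fsubsetP; exact: cluster_mono.
Qed.

Let reach_exit (S : {fset V}) x y u : (S `<=` L)%fset -> (forall v, x v -> y v) ->
  u \in site_cluster nb S [set o] x -> u \in exit_cluster y -> o \in exit_cluster y.
Proof.
move=> SL xy /clusterP; elim=> [v -> //|v w vr IH vw _ wH].
apply: IH; have [vS xv] := reach_sub vr.
apply: (cluster_nb wH) => //; [by rewrite nbC|exact: (fsubsetP SL)|exact: xy].
Qed.

Let pivotal v x : R :=
  (o \in exit_cluster (upd x v true))%:R - (o \in exit_cluster (upd x v false))%:R.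

Let exit_increasing : increasing (fun x => (o \in exit_cluster x)%:R : R).
Proof.
move=> x y xy; apply: ler_nat_bool.
by apply: fsubsetP; exact: cluster_mono.
Qed.

Let pivotal_ge0 v x : 0 <= pivotal v x.
Proof. by rewrite subr_ge0; exact: (increasing_upd_le v x exit_increasing). Qed.

Let pivotal1 v x : o \notin exit_cluster x -> ~~ x v ->
  o \in exit_cluster (upd x v true) -> pivotal v x = 1.
Proof.
move=> oH xv oH'; rewrite /pivotal oH' (_ : upd x v false = x) ?(negbTE oH) ?subr0//.
by apply/funext => u; rewrite /upd; case: eqP => // ->; case: (x v) xv.
Qed.

Let escapes (S : {fset V}) x : R :=
  \sum_(w <- outer_boundary nb S) (has (mem (site_cluster nb S [set o] x)) (nb w))%:R.

(** If [o] is unexplored, every closed vertex surrounding the unexplored region and adjacent to the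
    cluster of [o] there is pivotal. If [o] is inspected but not connected to the boundary, it is
    closed and itself pivotal. *)
Let pivotal_sum x :
  (o \in unexplored x)%:R * escapes (unexplored x) x +
  ((o \notin exit_cluster x) && (o \notin unexplored x))%:R
  <= \sum_(v <- L) pivotal v x.
Proof.
have [oU|oU] := boolP (o \in unexplored x); rewrite /= ?mul1r ?mul0r ?andbF ?andbT ?addr0 ?add0r.
  rewrite /escapes [leRHS](bigID (fun v => v \in outer_boundary nb (unexplored x))) /=.
  rewrite -[leLHS]addr0; apply: lerD; last by apply: sumr_ge0.
  rewrite -[leRHS]big_filter [leRHS](perm_big (outer_boundary nb (unexplored x))) /=.
    rewrite big_seq [leRHS]big_seq. apply: ler_sum => w wS.
    have [wE xw] := boundary_closed wS.
    case: hasP => [[u uw /= uC]|_]; last exact: pivotal_ge0.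
    rewrite pivotal1 ?unexplored_exit//.
    have xu v : x v -> upd x w true v by rewrite /upd; case: eqP.
    have UL : (unexplored x `<=` L)%fset by exact: fsubsetDl.
    apply: (reach_exit UL xu uC); apply: (cluster_nb (open_explored wE)) => //.
      by apply: (fsubsetP UL); exact: (fsubsetP (cluster_sub _ _ _ _) _ uC).
    exact/xu/(cluster_open uC).
  rewrite uniq_perm ?filter_uniq// => w; rewrite mem_filter.
  case: (boolP (w \in outer_boundary _ _)) => //= /boundary_closed[+ _].
  by rewrite in_explored => /andP[].
have [oH|oH] := boolP (o \in exit_cluster x); first by rewrite sumr_ge0.
have oE : o \in explored nb L inner_boundary (exit_cluster x).
  by apply: contraNT oU => oE; rewrite in_fsetD oE.
rewrite (big_rem o)//= pivotal1//; first by rewrite lerDl sumr_ge0.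
  by apply: contra oH => xo; exact: explored_open oE xo.
exact: open_explored.
Qed.

(** Given that the unexplored region is [S], the sites of [S] are still independent, so the mean of
    [escapes S] is [escape S o], at least 1 when [o] lies in [S]. The two cases of [pivotal_sum]
    then add up to the probability that [o] is not connected to the boundary. *)
Let exit_derivative q : 0 <= q <= 1 ->
  (forall S : {fset V}, o \in S -> 1 <= escape nb (fun=> q) S o) ->
  1 - exit_proba q <=
    \sum_(v <- L) bexpect (fun=> q) L (pivotal v).
Proof.
move=> q01 phi1.
rewrite -expect_sum -/(bexpect _ _ _).
pose Q : V -> R := fun=> q.
have Q01 v : 0 <= Q v <= 1 by [].
apply: le_trans (le_bexpect _ Q01 pivotal_sum).
rewrite /bexpect expectD -!/(bexpect _ _ _).
(* The signs are reversed because [le_bexpect_explore] gives upper bounds. *)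
have h : bexpect Q L (fun x => - ((o \in unexplored x)%:R * escapes (unexplored x) x)) <=
         bexpect Q L (fun x => - (o \in unexplored x)%:R).
  pose H (S : {fset V}) x : R := - ((o \in S)%:R * escapes S x).
  apply: (le_bexpect_explore (W := L) (D := fun S : {fset V} => ~` [set` S]) (H := H)
     (c := fun S : {fset V} => - (o \in S)%:R)) => //.
  - by move=> x; exact: fsubsetDl.
  - move=> S; rewrite setCK => x y xy; rewrite /H /escapes; congr (- (_ * _)).
    by apply: eq_bigr => w _; rewrite (dep_on_cluster nbC _ xy).
  - move=> S SL; rewrite /H; case: (boolP (o \in S)) => oS; last first.
      rewrite -[leRHS](bexpect_const Q L); apply: le_bexpect => // x.
      by rewrite mul0r.
    rewrite /bexpect (eq_expect _ _ _ (_ : _ =1 fun x => -1 * escapes S x)); last first.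
      by move=> x; rewrite mul1r mulN1r.
    rewrite expectZ mulN1r lerN2 /escapes expect_sum (le_trans (phi1 _ oS))//.
    apply: ler_sum => w _; rewrite -!/(bexpect _ _ _) (@bexpect_restrict _ _ Q S L)//.
      exact: fsubsetP.
    by move=> x y xy; rewrite (dep_on_cluster nbC _ xy).
rewrite /bexpect !expectN lerN2 -!/(bexpect _ _ _) in h.
apply: le_trans (lerD h (lexx _)).
rewrite lerBlDr /exit_proba -[leLHS](bexpect_const Q L) /bexpect -!expectD.
rewrite -!/(bexpect _ _ _); apply: le_bexpect => // x.
by case: (o \in unexplored x); case: (o \in exit_cluster x);
  rewrite /= ?addr0 ?add0r// ?lerDl.
Qed.

(** Since [escape] increases with the parameter, theta' >= 1 - theta on [q, q'], where theta is
    [exit_proba]. The mean value theorem gives theta(q') >= (q' - q) (1 - theta(q')), which is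
    solved for theta(q'). *)
Theorem exit_proba_lower_bound q q' : 0 <= q -> q < q' -> q' <= 1 ->
  (forall S : {fset V}, o \in S -> 1 <= escape nb (fun=> q) S o) ->
  (q' - q) / (1 + (q' - q)) <= exit_proba q'.
Proof.
move=> q0 qq' q'1 phi1.
have phi p : q <= p <= 1 -> forall S : {fset V}, o \in S -> 1 <= escape nb (fun=> p) S o.
  move=> /andP[qp p1] S oS; apply: le_trans (phi1 _ oS) _; apply: ler_sum => w _.
  apply: bexpect_mono => [x y xy|//].
  apply: ler_nat_bool => /hasP[u uw uC]; apply/hasP; exists u => //.
  by move: uC => /=; apply: fsubsetP; exact: cluster_mono.
have mono (p p' : R) : 0 <= p -> p <= p' -> p' <= 1 -> exit_proba p <= exit_proba p'.
  by move=> *; apply: bexpect_mono.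
have der (p : R) : is_derive p 1 exit_proba (\sum_(v <- L) bexpect (fun=> p) L (pivotal v)).
  exact: russo.
have [|c] := MVT qq' (fun p _ => der p).
  apply: derivable_within_continuous => p _; exact: ex_derive.
rewrite in_itv /= => /andP[qc cq'] E.
have c01 : 0 <= c <= 1 by lra.
have h1 := exit_derivative c01 (phi c _).
have h2 : exit_proba c <= exit_proba q' by apply: mono; lra.
have h3 : 0 <= exit_proba q.
  rewrite -(bexpect_const (fun=> q) L 0); apply: le_bexpect => [v|x]; last exact: ler0n.
  by lra.
rewrite ler_pdivrMr; last by lra.
have : 1 - exit_proba c <= \sum_(v <- L) bexpect (fun=> c) L (pivotal v) by apply: h1; lra.
move: E; set D := \sum_(_ <- _) _ => E h4.
have : (1 - exit_proba q') * (q' - q) <= D * (q' - q) by apply: ler_wpM2r; lra.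
by rewrite -E; lra.
Qed.

End sharpness.

(** * Local events under a product law *)

Section product_law.
Variables (R : realType) (I : choiceType) (A : pointedType) (al : seq A) (w : A -> R).
Hypotheses (al_uniq : uniq al) (al_full : forall a, a \in al).
Variable P : probability (config I A) R.
Hypothesis Pw : is_product_law w P.

Let cylinder_measurable (J : {fset I}) (t : I -> A) :
  measurable ([set x | forall i, i \in J -> x i = t i] : set (config I A)).
Proof.
rewrite (_ : [set x | _] = \bigcap_(i in [set` J]) [set x : config I A | x i = t i]) //.
apply: fin_bigcap_measurable => // i _.
apply: sub_sigma_algebra; by exists i, (t i).
Qed.

(** The fixed cylinder over [J] serves the induction: each step moves one site from [s] into [J] and
    splits the event according to its value. *)
Let cylinder_law (s : seq I) (J : {fset I}) (t : I -> A) (E : (I -> A) -> bool) :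
  uniq s -> (forall i, i \in s -> i \notin J) -> dep_on [set` s] E ->
  let X : set (config I A) := [set x | (forall i, i \in J -> x i = t i) /\ E x] in
  measurable X /\ P X = ((\prod_(i <- J) w (t i)) * expect al (fun=> w) s (fun x => (E x)%:R))%:E.
Proof.
elim: s J t E => [|v s IH] J t E /=.
  move=> _ _ E0; have EE x : E x = E (fun=> point) by exact: E0.
  case: (boolP (E (fun=> point))) EE => _ EE.
    rewrite (_ : [set x | _] = [set x | forall i, i \in J -> x i = t i]).
      by split; [exact: cylinder_measurable|rewrite mulr1 Pw].
    by apply/seteqP; split => x /=; [case|rewrite EE].
  rewrite (_ : [set x | _] = set0) ?measure0 ?mulr0//.
  by apply/seteqP; split => x //= []; rewrite EE.
move=> /andP[vs us] sJ Es.
have vJ : v \notin J by apply: sJ; rewrite inE eqxx.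
pose X a : set (config I A) :=
  [set x | (forall i, i \in (v |` J)%fset -> x i = upd t v a i) /\ E (upd x v a)].
have XE : [set x : config I A | (forall i, i \in J -> x i = t i) /\ E x] =
    \bigcup_(a in [set` al]) X a.
  apply/seteqP; split => x /=.
    move=> [xt Ex]; exists (x v); first exact: al_full.
    rewrite /X /= (_ : upd x v (x v) = x); last first.
      by apply/funext => u; rewrite /upd; case: eqP => [->|].
    split=> // i; rewrite in_fset1U /upd; case: eqP => [->//|_ /=]; exact: xt.
  move=> [a _ [xt Ex]]; have xv : x v = a by rewrite xt ?in_fset1U ?eqxx// /upd eqxx.
  split=> [i iJ|].
    rewrite xt ?in_fset1U ?iJ ?orbT// /upd; case: eqP => // iv.
    by rewrite -iv iJ in vJ.
  rewrite (_ : x = upd x v a)//; apply/funext => u; rewrite /upd; case: eqP => [->|//].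
  exact: xv.
have XP a : measurable (X a) /\ P (X a) =
    ((\prod_(i <- J) w (t i)) * (w a * expect al (fun=> w) s (fun x => (E (upd x v a))%:R)))%:E.
  have [||mX ->] := IH (v |` J)%fset (upd t v a) (fun x => E (upd x v a)) us.
  - move=> i is_; rewrite in_fset1U negb_or sJ ?inE ?is_ ?orbT// andbT.
    by apply: contraNneq vs => <-.
  - apply: (dep_on_sub _ (dep_on_upd a Es)) => u [/=]; rewrite inE.
    by case: eqVneq.
  split=> //; congr EFin; rewrite big_fsetU1//= {1}/upd eqxx [RHS]mulrA; congr (_ * _).
  rewrite mulrC; congr (_ * _); rewrite big_seq [RHS]big_seq; apply: eq_bigr => i iJ.
  by rewrite /upd; case: eqP iJ => // ->; rewrite (negbTE vJ).
have fX : finite_set [set` al] by exact: finite_seq.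
rewrite XE; split; first by apply: fin_bigcup_measurable => // a _; have [] := XP a.
rewrite measure_fin_bigcup//; last 2 first.
- move=> a b _ _ [x [[xa _] [xb _]]].
  by move: (xa v) (xb v); rewrite in_fset1U eqxx /upd eqxx => /(_ isT) <- /(_ isT).
- by move=> a _; have [] := XP a.
rewrite -fsbig_seq// mulr_sumr -sumEFin; apply: eq_bigr => a _.
exact: (XP a).2.
Qed.

Lemma local_event_law (s : seq I) (E : (I -> A) -> bool) :
  uniq s -> dep_on [set` s] E ->
  let X : set (config I A) := [set x | E x] in
  measurable X /\ P X = (expect al (fun=> w) s (fun x => (E x)%:R))%:E.
Proof.
move=> us Es; have [//|mX PX] := @cylinder_law s fset0 (fun=> point) E us _ Es.
move: mX PX; rewrite big_seq_fset0 mul1r (_ : [set x | _] = [set x | E x])//.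
by apply/seteqP; split => x //= [].
Qed.

End product_law.

(** * Boxes and translations *)

Section box.
Variable V : countType.

(** An increasing exhaustion by finite sets, read off an enumeration of [V]; these are not geometric
    cubes. *)
Definition box (n : nat) : {fset V} := [fset v in pmap (@pickle_inv V) (iota 0 n)]%fset.

Lemma in_box n v : (v \in box n) = (choice.pickle v < n)%N.
Proof.
rewrite !inE /= mem_pmap; apply/mapP/idP => [[i]|vn].
  rewrite mem_iota add0n => /andP[_ i_n] /esym E.
  by have := @pickle_invK V i; rewrite E /= => ->.
by exists (choice.pickle v); rewrite ?mem_iota ?add0n// pickleK_inv.
Qed.

Lemma box_mono m n : (m <= n)%N -> (box m `<=` box n)%fset.
Proof. by move=> mn; apply/fsubsetP => v; rewrite !in_box => /leq_trans; exact. Qed.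

Lemma sub_box (s : seq V) : exists n, {subset s <= box n}.
Proof.
exists (\max_(v <- s) choice.pickle v).+1 => v vs.
by rewrite in_box ltnS (big_rem v)//= leq_maxl.
Qed.

End box.

Section translation.
Variables (R : realType) (V : choiceType) (nb : V -> seq V) (t t' : V -> V).
Hypotheses (tK : cancel t t') (t'K : cancel t' t).
Hypothesis nbt : forall v w, (t w \in nb (t v)) = (w \in nb v).

Lemma expect_map (A : pointedType) (al : seq A) (w : A -> R) (s : seq V) f :
  expect al (fun=> w) (map t s) f = expect al (fun=> w) s (fun x => f (x \o t')).
Proof.
elim: s f => //= v s IH f; apply: eq_bigr => a _; rewrite IH; congr (_ * _).
apply: eq_expect => x; congr f; apply/funext => u.
by rewrite /upd /= -{1}[u]t'K (can_eq tK).
Qed.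

Lemma perm_imfset (S : {fset V}) : perm_eq (t @` S)%fset (map t S).
Proof.
apply: uniq_perm; rewrite ?(map_inj_uniq (can_inj tK))// => v.
by apply/imfsetP/mapP => -[u /= uS ->]; exists u.
Qed.

Lemma mem_imfset_can (S : {fset V}) v : (t v \in (t @` S)%fset) = (v \in S).
Proof. by rewrite (perm_mem (perm_imfset S)) mem_map//; exact: can_inj tK. Qed.

Lemma reach_translate (D Z D' Z' : set V) v : (forall u, D u -> D' (t u)) ->
  (forall u, Z u -> Z' (t u)) -> reach nb D Z v -> reach nb D' Z' (t v).
Proof.
move=> DD ZZ; elim=> [u Zu Du|u w _ IH uw Dw]; first by apply: reach_src; auto.
by apply: (reach_step IH); [rewrite nbt|auto].
Qed.
End translation.

Section translation_escape.
Variables (R : realType) (V : choiceType) (nb : V -> seq V) (t t' : V -> V).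
Hypotheses (tK : cancel t t') (t'K : cancel t' t).
Hypothesis nbt : forall v w, (t w \in nb (t v)) = (w \in nb v).

Lemma site_cluster_translate (S : {fset V}) z x v :
  (t v \in site_cluster nb (t @` S)%fset [set t z] (x \o t')) =
  (v \in site_cluster nb S [set z] x).
Proof.
apply/clusterP/clusterP => vr.
  rewrite -[v]tK; apply: (reach_translate _ _ _ vr) => [v' w'|u [/imfsetP[u' /= u'S ->]]|u ->].
  - by rewrite -[v' in RHS]t'K -[w' in RHS]t'K nbt.
  - by rewrite /= tK.
  - by rewrite tK.
apply: (reach_translate nbt _ _ vr) => [u [uS xu]|u ->//].
by split; rewrite /= ?tK// (mem_imfset_can tK).
Qed.

Lemma mem_outer_boundary_translate (S : {fset V}) w :
  (t w \in outer_boundary nb (t @` S)%fset) = (w \in outer_boundary nb S).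
Proof.
apply/outer_boundaryP/outer_boundaryP => -[]; rewrite (mem_imfset_can tK) => wS.
  by move=> [_ /imfsetP[u /= uS ->]]; rewrite nbt => uw; split=> //; exists u.
move=> [u uS uw]; split; rewrite ?(mem_imfset_can tK)//; exists (t u); rewrite ?nbt//.
by rewrite (mem_imfset_can tK).
Qed.

Lemma perm_outer_boundary_translate (S : {fset V}) :
  perm_eq (outer_boundary nb (t @` S)%fset) (map t (outer_boundary nb S)).
Proof.
apply: uniq_perm; rewrite ?(map_inj_uniq (can_inj tK))// => v.
by rewrite -[v]t'K mem_outer_boundary_translate mem_map//; exact: can_inj tK.
Qed.

Lemma escape_translate (q : R) (S : {fset V}) z :
  escape nb (fun=> q) (t @` S)%fset (t z) = escape nb (fun=> q) S z.
Proof.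
rewrite /escape (perm_big _ (perm_outer_boundary_translate S)) big_map.
apply: eq_bigr => w _.
rewrite /bexpect (expect_perm _ _ _ (perm_imfset tK S))//.
rewrite (expect_map tK t'K _ (fun b => if b then q else 1 - q)).
apply: eq_expect => x; congr (nat_of_bool _)%:R.
apply/hasP/hasP => -[u uw /= uC].
  exists (t' u); first by rewrite -nbt t'K.
  by rewrite /= -site_cluster_translate t'K.
by exists (t u); rewrite ?nbt//= site_cluster_translate.
Qed.

End translation_escape.

(** * Percolation on the body centered cubic lattice *)

Definition bcc_steps : seq (int * int * int) :=
  [:: (2, 0, 0); (-2, 0, 0); (0, 2, 0); (0, -2, 0); (0, 0, 2); (0, 0, -2);
      (1, 1, 1); (1, 1, -1); (1, -1, 1); (1, -1, -1);
      (-1, 1, 1); (-1, 1, -1); (-1, -1, 1); (-1, -1, -1)].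

Definition bcc_nb (v : cell) : seq cell := pmap insub [seq val v - d | d <- bcc_steps].

Lemma bcc_nbE v w : (w \in bcc_nb v) = (val v - val w \in bcc_steps).
Proof.
rewrite mem_pmap_sub; apply/mapP/idP => [[d dD E]|h].
  by rewrite [val w]E opprB addrC subrK.
by exists (val v - val w); rewrite // opprB addrC subrK.
Qed.

Lemma bcc_adjacentE v w : bcc_adjacent v w = (w \in bcc_nb v).
Proof. by rewrite bcc_nbE. Qed.

Lemma bcc_stepsN d : (- d \in bcc_steps) = (d \in bcc_steps).
Proof.
suff H e : e \in bcc_steps -> - e \in bcc_steps.
  by apply/idP/idP => /H//; rewrite opprK.
have /allP : all (fun e => - e \in bcc_steps) bcc_steps by [].
exact.
Qed.

Lemma bcc_nbC v w : (w \in bcc_nb v) = (v \in bcc_nb w).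
Proof. by rewrite !bcc_nbE -bcc_stepsN opprB. Qed.

Lemma size_bcc_nb v : (size (bcc_nb v) <= 14)%N.
Proof. by rewrite size_pmap (leq_trans (count_size _ _))// size_map. Qed.

Lemma in_bccD (a b : int * int * int) : in_bcc a -> in_bcc b -> in_bcc (a + b).
Proof. by case: a => [[a1 a2] a3]; case: b => [[b1 b2] b3]; rewrite /in_bcc /=; lia. Qed.

Lemma in_bccN (a : int * int * int) : in_bcc a -> in_bcc (- a).
Proof. by case: a => [[a1 a2] a3]; rewrite /in_bcc /=; lia. Qed.

Definition translate (a v : cell) : cell :=
  exist in_bcc (val a + val v) (in_bccD (valP a) (valP v)).

Definition cell_opp (a : cell) : cell := exist in_bcc (- val a) (in_bccN (valP a)).

Lemma translateK a : cancel (translate a) (translate (cell_opp a)).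
Proof. by move=> v; apply: val_inj; rewrite /= addKr. Qed.

Lemma translateNK a : cancel (translate (cell_opp a)) (translate a).
Proof. by move=> v; apply: val_inj; rewrite /= addNKr. Qed.

Lemma bcc_nb_translate a v w : (translate a w \in bcc_nb (translate a v)) = (w \in bcc_nb v).
Proof. by rewrite !bcc_nbE /= opprD addrACA subrr add0r. Qed.

Lemma translate_origin a : translate a origin = a.
Proof. by apply: val_inj; rewrite /= addr0. Qed.

Section critical.
Variable R : realType.
Implicit Types (q : R) (x : config cell bool) (L : {fset cell}).

Let exits_box x n : bool := origin \in exit_cluster bcc_nb (box cell n) x.

(** An open path from [v] to the boundary of [L'] either stays in [L] or crosses the boundary of
    [L]; so the exit events decrease along the boxes. *)
Lemma exit_cluster_sub (L L' : {fset cell}) x v : (L `<=` L')%fset -> v \in L ->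
  v \in exit_cluster bcc_nb L' x -> v \in exit_cluster bcc_nb L x.
Proof.
move=> LL' + /clusterP vr.
elim: vr => [u /hasP[w wu wL'] [_ xu] uL|u w _ IH uw [_ xw] wL].
  apply/clusterP; apply: reach_src => //; apply/hasP; exists w => //.
  by apply: contra wL'; exact: fsubsetP.
have [uL|uL] := boolP (u \in L); first exact: (cluster_nb (IH uL)).
apply/clusterP; apply: reach_src => //; apply/hasP; exists u => //.
by rewrite bcc_nbC.
Qed.

Lemma open_clusterP x v : open_cluster x origin v <->
  reach bcc_nb [set w | x w] [set origin] v.
Proof.
split=> [[xo /clos_rt_rtn1_iff]|].
  elim=> [|u w [xu xw uw] _ IH]; first exact: reach_src.
  by apply: (reach_step IH) => //; rewrite -bcc_adjacentE.
elim=> [u -> xo|u w ur [xo ou] uw xw]; first by split=> //; exact: rt_refl.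
split=> //; apply: rt_trans ou _; apply: rt_step; split=> //.
  exact: (reach_sub ur).
by rewrite bcc_adjacentE.
Qed.

Lemma infinite_open_clusterP x N : origin \in box cell N ->
  infinite_set (open_cluster x origin) <-> (forall n, (N <= n)%N -> exits_box x n).
Proof.
move=> oN; split=> [xinf n Nn|xex].
  have on : origin \in box cell n by apply: fsubsetP oN; exact: box_mono.
  apply: contra_notT xinf => oex.
  apply: (@sub_finite_set _ _ [set` box cell n]); last exact: finite_fset.
  suff H v : reach bcc_nb [set w | x w] [set origin] v ->
      v \in box cell n /\ v \notin exit_cluster bcc_nb (box cell n) x.
    by move=> v /open_clusterP /H[].
  elim=> [u -> _|u w ur [un uex] uw xw]; first by [].
  have xu : x u := reach_sub ur.
  have wn : w \in box cell n.
    apply: contraNT uex => wn; apply/clusterP; apply: reach_src => //.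
    by apply/hasP; exists w.
  split=> //; apply: contra uex => wex.
  by apply: (cluster_nb wex) => //; rewrite bcc_nbC.
move=> /finite_seqP[s sE].
(* This box contains the finite cluster's neighbours, so no member of the cluster has a neighbour
   outside it. *)
have [n sn] := sub_box (flatten [seq bcc_nb v | v <- s] ++ box cell N).
have Nn : (N <= maxn n N)%N by rewrite leq_maxr.
have /clusterP := xex _ Nn.
have xo : x origin by have := xex _ Nn => /cluster_open.
suff H v : reach bcc_nb (open_in (box cell (maxn n N)) x) (inner_boundary bcc_nb (box cell (maxn n N))) v ->
   exists2 b, inner_boundary bcc_nb (box cell (maxn n N)) b &
    reach bcc_nb [set w | x w] [set v] b.
  move=> /H[b /hasP[w wb wn] /open_clusterP].
  rewrite sE /= => bs; move: wn; apply/negP; rewrite negbK.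
  apply: (fsubsetP (box_mono _ (leq_maxl n N))); apply: sn; rewrite mem_cat; apply/orP; left.
  by apply/flattenP; exists (bcc_nb b) => //; apply/mapP; exists b.
elim=> [u ub [_ xu]|u w _ [b bb bu] wu [_ xw]].
  by exists u => //; apply: reach_src.
exists b => //.
suff K c : reach bcc_nb [set w | x w] [set u] c -> reach bcc_nb [set w | x w] [set w] c by exact: K.
elim=> [_ -> xu|a d _ IH ad xd]; last exact: reach_step IH ad xd.
by apply: (@reach_step _ _ _ _ w) => //; [exact: reach_src|rewrite bcc_nbC].
Qed.

(** Otherwise the exit probabilities at some larger parameter without percolation stay above a
    positive constant in all boxes, and continuity from above makes the percolation probability
    positive. *)
Theorem escape_subcritical q : 0 <= q < p_c R ->
  exists2 S : {fset cell}, origin \in S & escape bcc_nb (fun=> q) S origin < 1.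
Proof.
move=> /andP[q0 qpc]; apply: contrapT => noS.
have phi1 S : origin \in S -> 1 <= escape bcc_nb (fun=> q) S origin.
  by move=> oS; rewrite leNgt; apply/negP => ?; apply: noS; exists S.
have [q' [/= /andP[q'0 q'1] perc0] qq'] : exists2 q', [set q : R | 0 <= q <= 1 /\ percolation_proba q = 0%E] q' & q < q'.
  (* The supremum of the empty set is 0 by convention, which contradicts 0 <= q < p_c. *)
  apply: sup_gt => //; apply/set0P/eqP => S0.
  by move: qpc; rewrite /p_c S0 sup0 ltNge q0.
have [N oN'] := sub_box [:: origin].
have oN : origin \in box cell N by apply: oN'; rewrite inE.
pose F n : set (config cell bool) := [set x | exits_box x (n + N)].
have on n : origin \in box cell (n + N) by apply: fsubsetP oN; rewrite box_mono// leq_addl.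
have FP n : measurable (F n) /\ (site_law q') (F n) = (exit_proba bcc_nb (box cell (n + N)) origin q')%:E.
  apply: (@local_event_law _ _ _ [:: true; false] _ _ _ _ (site_lawP _)) => //.
  - by case.
  - by rewrite q'0.
  - by move=> x y xy; rewrite /exits_box /exit_cluster (dep_on_cluster bcc_nbC _ xy).
have capF : \bigcap_n F n = [set x | infinite_set (open_cluster x origin)].
  apply/seteqP; split => x /=.
    move=> xF; apply/(infinite_open_clusterP x oN) => n Nn.
    by have := xF (n - N)%N Logic.I; rewrite /F /= subnK.
  by move=> /(infinite_open_clusterP x oN) xF n _; apply: xF; rewrite leq_addl.
have mF n : measurable (F n) := (FP n).1.
have cvF : site_law q' \o F @ \oo --> site_law q' (\bigcap_n F n).
  apply: nonincreasing_cvg_mu => //.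
  - by rewrite (le_lt_trans (probability_le1 _ (mF 0%N)))// ltry.
  - exact: bigcap_measurable.
  - move=> m n mn; apply/subsetPset => x; apply: exit_cluster_sub => //.
    by rewrite box_mono// leq_add2r.
have c0 : 0 < (q' - q) / (1 + (q' - q)) by rewrite divr_gt0//; lra.
have : (((q' - q) / (1 + (q' - q)))%:E <= site_law q' (\bigcap_n F n))%E.
  rewrite -(cvg_lim _ cvF)//; apply: lime_ge; first by apply/cvg_ex; exists (site_law q' (\bigcap_n F n)).
  apply: nearW => n /=; have [_ ->] := FP n; rewrite lee_fin.
  by apply: exit_proba_lower_bound => //; exact: bcc_nbC.
by rewrite capF -/(percolation_proba q') perc0 lee_fin leNgt c0.
Qed.

End critical.

(** * Domination of the yellow cells with a blue neighbour *)

Lemma cluster_moment_subcritical (R : realType) (q : R) : 0 <= q < p_c R -> q <= 1 ->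
  exists tau K : R, [/\ 1 < tau, 1 < K & forall (U : {fset cell}) (Z : seq cell),
    bexpect (fun=> q) U (fun x => tau ^+ #|` site_cluster bcc_nb U [set` Z] x|) <= K ^+ size Z].
Proof.
move=> qpc q1; have [S oS phi] := escape_subcritical qpc.
have q01 : 0 <= q <= 1 by rewrite q1; case/andP: qpc => ->.
(* Translation invariance carries the set found at the origin to every cell, with uniform bounds. *)
pose T z := (translate z @` S)%fset.
apply: (@cluster_exp_moment R cell bcc_nb bcc_nbC (fun=> q) _ T _
  #|` S| #|` outer_boundary bcc_nb S| phi) => // z.
split.
- by apply/imfsetP; exists origin => //; rewrite translate_origin.
- by rewrite card_imfset//; exact: can_inj (translateK z).
- rewrite (perm_size (perm_outer_boundary_translate (translateK z) (translateNK z)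
    (bcc_nb_translate z) S)) size_map//.
- by rewrite -{2}[z]translate_origin (escape_translate (translateK z) (translateNK z) (bcc_nb_translate z)).
Qed.

Section domination.
Variables (R : realType) (V : choiceType).
Implicit Types (pi rho : V -> R) (s r : seq V) (g : (V -> bool) -> R).

(** All bits allowed by [N] equal 1 with probability b^count; on the complement [g] is bounded below
    by its value at the zero configuration. *)
Lemma bexpect_all_or_none (N : pred V) (b : R) s g : 0 <= b <= 1 -> increasing g ->
  b ^+ count N s * g (fun v => (v \in s) && N v) + (1 - b ^+ count N s) * g (fun=> false) <=
  bexpect (fun v => if N v then b else 0) s g.
Proof.
move=> b01; have rho01 v : 0 <= (if N v then b else 0) <= 1 by case: ifP; lra.
elim: s g => [|v s IH] g gi /=.
  by rewrite expr0 subrr mul0r addr0 mul1r; apply: gi.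
rewrite bexpect_cons; set G := g (fun u => (u \in v :: s) && N u).
have h1 := IH _ (increasing_upd v true gi).
have h2 := IH _ (increasing_upd v false gi).
case: ifP => Nv; rewrite /= ?add1n ?add0n; last first.
  rewrite mul0r add0r subr0 mul1r; apply: le_trans h2.
  apply: lerD; last by rewrite (_ : upd _ _ _ = fun=> false)//; apply/funext => u; rewrite /upd; case: eqP.
  rewrite /G (_ : upd _ _ _ = fun u => (u \in v :: s) && N u)//.
  by apply/funext => u; rewrite /upd inE; case: eqP => // ->; rewrite Nv andbF.
have E1 : g (upd (fun u => (u \in s) && N u) v true) = G.
  by congr g; apply/funext => u; rewrite /upd inE; case: eqP => // ->; rewrite Nv.
have h3 : g (fun=> false) <= g (upd (fun=> false) v true) by apply: gi.
have h4 : g (fun=> false) <= bexpect (fun v => if N v then b else 0) s (fun x => g (upd x v false)).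
  rewrite -[leLHS](bexpect_const (fun v => if N v then b else 0) s).
  by apply: le_bexpect => // x; apply: gi.
rewrite E1 in h1; rewrite exprS.
have c01 : 0 <= b ^+ count N s <= 1 by rewrite exprn_ge0 ?exprn_ile1//; lra.
set c := b ^+ _ in h1 c01 *; set g0 := g _ in h3 h4 h1 *.
set X := bexpect _ _ _ in h1 *; set Y := bexpect _ _ _ in h4 *.
set g1 := g _ in h1 h3.
have h5 : (1 - c) * g0 <= (1 - c) * g1 by apply: ler_wpM2l; lra.
have h6 : b * (c * G + (1 - c) * g0) <= b * X by apply: ler_wpM2l; lra.
have h7 : (1 - b) * g0 <= (1 - b) * Y by apply: ler_wpM2l; lra.
lra.
Qed.

(* Each bit B w is replaced by independent bits of parameter b, one for every v
   related to w, all of which equal 1 with probability at least beta; for distinct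
   v the maxima over w then involve disjoint families of bits. *)
Lemma bexpect_neighbourhood (N : V -> pred V) (beta b : R) (k : nat) s r g :
  0 <= beta -> 0 <= b <= 1 -> beta <= b ^+ k ->
  (forall w, w \in r -> (count (N w) s <= k)%N) -> (forall w v, N w v -> v \in s) ->
  uniq r -> increasing g ->
  bexpect (fun=> beta) r (fun B => g (fun v => has (fun w => B w && N w v) r)) <=
  bexpect (fun v => 1 - \prod_(w <- r) (1 - if N w v then b else 0)) s g.
Proof.
move=> beta0 b01 betab + Ns; have b0 : 0 <= b by lra.
have rho01 (w v : V) : 0 <= (if N w v then b else 0) <= 1 by case: ifP; lra.
have beta1 : beta <= 1 by rewrite (le_trans betab)// exprn_ile1//; lra.
have pi01 (r' : seq V) v : 0 <= 1 - \prod_(w <- r') (1 - if N w v then b else 0) <= 1.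
  have : 0 <= \prod_(w <- r') (1 - if N w v then b else 0) <= 1.
    elim: r' => [|w r' IH]; first by rewrite big_nil ler01 lexx.
    rewrite big_cons; have := rho01 w v; set x := (if _ then _ else _) => ?; nra.
  lra.
elim: r g => [|w r IH] g Nk /=.
  move=> _ gi; rewrite {1}/bexpect /= -[leLHS](bexpect_const (fun v =>
    1 - \prod_(w <- [::]) (1 - if N w v then b else 0)) s).
  by apply: le_bexpect => // x; apply: gi.
(* [Phi] is [g] averaged over the bit of [w], which then leaves the induction. *)
move=> /andP[wr ur] gi; pose Phi (d : V -> bool) : R :=
  beta * g (fun v => N w v || d v) + (1 - beta) * g d.
have Phi_inc : increasing Phi.
  move=> x y xy; apply: lerD; apply: ler_wpM2l => //; rewrite ?subr_ge0//; apply: gi => //.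
  by move=> v /orP[->//|/xy ->]; rewrite orbT.
apply: (@le_trans _ _ (bexpect (fun=> beta) r (fun B => Phi (fun v => has (fun w => B w && N w v) r)))).
  rewrite bexpect_cons /Phi /bexpect expectD !expectZ -!/(bexpect _ _ _).
  have E a (B : V -> bool) v : has (fun u => upd B w a u && N u v) r = has (fun u => B u && N u v) r.
    apply: eq_in_has => u ur'; have uw : u != w by apply: contraNneq wr => <-.
    by rewrite /upd (negbTE uw).
  rewrite /bexpect; under eq_expect do under eq_fun do rewrite E {1}/upd eqxx.
  under [X in _ + _ * X <= _]eq_expect do under eq_fun do rewrite E {1}/upd eqxx.
  by [].
apply: le_trans (IH Phi _ ur Phi_inc) _; first by move=> u ur'; apply: Nk; rewrite inE ur' orbT.
set pi := fun v => 1 - \prod_(w <- r) _.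
(* On the right, the private bits of [w] are joined by a disjunction to those of [r]: the
   probabilities of 0 multiply. *)
rewrite [leRHS]/bexpect -(@bexpect_op _ _ _ _ _ orb pi (fun v => if N w v then b else 0))//; last first.
  move=> v h; rewrite !big_cons big_nil /bernoulli_weight /pi /= big_cons; ring.
apply: le_bexpect => [v|d]; first exact: pi01.
have gdi : increasing (fun y : V -> bool => g (fun v => d v || y v)).
  by move=> x y xy; apply: gi => v /orP[->//|/xy ->]; rewrite orbT.
apply: le_trans _ (bexpect_all_or_none (N w) s b01 gdi).
rewrite /Phi (_ : (fun v => d v || (v \in s) && N w v) = fun v => N w v || d v); last first.
  apply/funext => v; rewrite orbC; congr (_ || _).
  by apply/andP/idP => [[]//|Nv]; split=> //; exact: Ns Nv.
rewrite (_ : g (fun v => d v || false) = g d); last by congr g; apply/funext => v; rewrite orbF.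
have h : g d <= g (fun v => N w v || d v) by apply: gi => v ->; rewrite orbT.
have : beta <= b ^+ count (N w) s.
  rewrite (le_trans betab)// ler_wiXn2l//; [lra..|]; exact: Nk (mem_head _ _).
set G := g (fun v => N w v || d v) in h *; set G0 := g d in h *; set B := b ^+ _.
move=> hB; have := ler_wpM2r (_ : 0 <= G - G0) hB; rewrite subr_ge0 => /(_ h).
lra.
Qed.

End domination.

Definition colors : seq color := [:: red; yellow; blue].

Lemma uniq_colors : uniq colors.
Proof. by rewrite /= !inE andbT negb_or -andbA; apply/and3P; split; apply/eqP. Qed.

Lemma mem_colors c : c \in colors.
Proof. by case: c; rewrite !inE eqxx ?orbT. Qed.

(** The ends of color [c1] of the green faces inside [s]. *)
Definition retained (s : {fset cell}) (c1 c2 : color) (x : cell -> color) (v : cell) : bool :=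
  [&& v \in s, x v == c1 & has (fun w => (w \in s) && (x w == c2)) (bcc_nb v)].

Section retained_domination.
Variables (R : realType) (p : color -> R).
Hypothesis tp : triangle p.

Lemma retained_domination (c1 c2 : color) (b : R) (k : nat) (s : {fset cell}) f :
  (forall v, (size (bcc_nb v) <= k)%N) ->
  (c1 = yellow /\ c2 = blue) \/ (c1 = blue /\ c2 = yellow) ->
  p c1 < 1 -> 0 <= b <= 1 -> p c2 <= b ^+ k * (1 - p c1) -> increasing f ->
  expect colors (fun=> p) s (fun x => f (retained s c1 c2 x)) <=
  bexpect (fun=> p c1 * (1 - (1 - b) ^+ k)) s f.
Proof.
move=> nbk c12 pc1 b01 pb fi; have [p01 psum] := tp.
pose beta := p c2 / (1 - p c1).
have d0 : 0 < 1 - p c1 by rewrite subr_gt0.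
have beta0 : 0 <= beta by rewrite divr_ge0 ?(ltW d0)//; have /andP[] := p01 c2.
have betab : beta <= b ^+ k by rewrite ler_pdivrMr.
have beta1 : beta <= 1 by rewrite (le_trans betab)// exprn_ile1//; lra.
have betaE : (1 - p c1) * beta = p c2 by rewrite mulrC divfK// gt_eqF.
(* The coloring comes from two independent bits: being [c1], and being [c2] given not [c1], with
   parameter [beta]. *)
pose col (a e : bool) := if a then c1 else if e then c2 else red.
have c1c2 : (c1 == c2) = false by case: c12 => -[-> ->]; apply/eqP.
have c1r : (c1 == red) = false by case: c12 => -[-> _]; apply/eqP.
have c2r : (c2 == red) = false by case: c12 => -[_ ->]; apply/eqP.
rewrite -(@bexpect_op _ _ _ colors (fun=> p) col (fun=> p c1) (fun=> beta))//; last first.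
  move=> _ h; rewrite !big_cons big_nil /col.
  transitivity (p c1 * h c1 + ((1 - p c1) * beta) * h c2 + (1 - p c1 - (1 - p c1) * beta) * h red).
    by ring.
  rewrite betaE; case: c12 => -[E1 E2]; rewrite E1 E2 -psum; ring.
set kappa := 1 - (1 - b) ^+ k.
have b'01 : 0 <= (1 - b) ^+ k <= 1 by rewrite exprn_ge0 ?exprn_ile1//; lra.
(* The target is the set [Y] of [c1] cells thinned independently by [kappa]; both sides can then be
   compared with [Y] fixed. *)
rewrite [leRHS]/bexpect -(@bexpect_op _ _ _ _ _ andb (fun=> p c1) (fun=> kappa))//; last first.
  by move=> v h; rewrite !big_cons big_nil /bernoulli_weight /=; ring.
apply: le_bexpect => [v|Y]; first exact: p01.
pose g (e : cell -> bool) := f (fun v => Y v && e v).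
have gi : increasing g.
  by move=> x y xy; apply: fi => v /andP[-> /xy].
pose N (w v : cell) := (v \in s) && (w \in bcc_nb v).
apply: (@le_trans _ _ (bexpect (fun=> beta) s (fun B => g (fun v => has (fun w => B w && N w v) s)))).
  apply: le_bexpect => [_|B]; first by rewrite beta0.
  apply: fi => v /and3P[vs /eqP + /hasP[w wv /andP[ws /eqP]]].
  rewrite /col; case: (Y v) => [_|]; last first.
    by case: (B v) => /eqP; rewrite eq_sym ?c1c2 ?c1r.
  case: (Y w) => [/eqP|]; first by rewrite c1c2.
  case: ifP => [Bw _|_ /eqP]; last by rewrite eq_sym c2r.
  by apply/hasP; exists w => //; rewrite Bw /N vs.
have countN (P : pred cell) (u : cell) : (forall v, P v -> v \in bcc_nb u) -> (count P s <= k)%N.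
  move=> Pu; rewrite -size_filter (leq_trans _ (nbk u))// uniq_leq_size ?filter_uniq ?fset_uniq//.
  by move=> v; rewrite mem_filter => /andP[/Pu].
apply: le_trans (bexpect_neighbourhood (s := s) beta0 b01 betab _ _ _ gi) _ => //.
- by move=> w _; apply: (countN (N w) w) => v; rewrite /N => /andP[_]; rewrite bcc_nbC.
- by move=> w v; rewrite /N => /andP[].
apply: bexpect_mono gi _ => v.
have E : \prod_(w <- s) (1 - if N w v then b else 0) = (1 - b) ^+ count (N^~ v) s.
  under eq_bigr do rewrite (fun_if (fun t => 1 - t)) subr0.
  by rewrite -big_mkcond big_const_seq iter_mulr_1.
rewrite E; have kv : (count (N^~ v) s <= k)%N by apply: (countN (N^~ v) v) => w; rewrite /N => /andP[].
have /andP[t0 t1] : 0 <= 1 - b <= 1 by case/andP: b01 => ? ?; rewrite subr_ge0 gerBl; apply/andP.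
rewrite subr_ge0 lerD2l lerN2 gerBl exprn_ge0// exprn_ile1//; split=> //.
by rewrite ler_wiXn2l.
Qed.

End retained_domination.

(** * Green clusters *)

Section graph_component.
Variables (V : Type) (e : V -> V -> Prop).
Implicit Types (S : set V).

Lemma sub_graph_component S S' v : S `<=` S' ->
  graph_component e S v `<=` graph_component e S' v.
Proof.
move=> SS' w [Sv vw]; split; first exact: SS'.
elim: vw => [a b [Sa Sb ab]|a|a b c _ ab _ bc]; last exact: rt_trans ab bc.
- by apply: rt_step; split=> //; exact: SS'.
- exact: rt_refl.
Qed.

(** A path has finitely many vertices, so it already lies in some [S n]. *)
Lemma graph_component_bigcup (S : nat -> set V) v : {homo S : m n / (m <= n)%N >-> m `<=` n} ->
  graph_component e (\bigcup_n S n) v = \bigcup_n graph_component e (S n) v.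
Proof.
move=> Smono; apply/seteqP; split => w; last first.
  by move=> [n _]; apply: sub_graph_component; exact: bigcup_sup.
move=> [[n0 _ n0v] vw].
suff [n [_ nvw]] : exists n, S n w /\ graph_component e (S n) v w by exists n.
elim: vw (ex_intro (fun n => S n v) n0 n0v) => {n0 n0v v w} [a b [_ [m _ mb] ab] [n na]|a [n na]|a b c _ ab _ bc].
- have [mk nk] : S m `<=` S (maxn m n) /\ S n `<=` S (maxn m n).
    by split; apply: Smono; rewrite ?leq_maxl ?leq_maxr.
  exists (maxn m n); split; first exact: mk.
  by split; [exact: nk|apply: rt_step; split=> //; [exact: nk|exact: mk]].
- by exists n; split=> //; split=> //; exact: rt_refl.
move=> /ab[m [mb mab]]; have [n [nc nbc]] := bc (ex_intro _ _ mb).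
have [mk nk] : S m `<=` S (maxn m n) /\ S n `<=` S (maxn m n).
  by split; apply: Smono; rewrite ?leq_maxl ?leq_maxr.
exists (maxn m n); split; first exact: nk.
have [ka kab] := sub_graph_component mk mab; have [_ kbc] := sub_graph_component nk nbc.
by split=> //; exact: rt_trans kab kbc.
Qed.

End graph_component.

Lemma card_le_bigcup (T : pointedType) (S : nat -> set T) (N : nat) :
  {homo S : m n / (m <= n)%N >-> m `<=` n} ->
  (`I_N #<= \bigcup_n S n)%card <-> exists n, (`I_N #<= S n)%card.
Proof.
move=> Smono; split=> [/pcard_leP[f]|[n /card_le_trans]]; last first.
  by apply; apply: subset_card_le; exact: bigcup_sup.
have [n nS] : exists n, forall i, (i < N)%N -> S n (f i).
  suff H k : (k <= N)%N -> exists n, forall i, (i < k)%N -> S n (f i) by exact: H.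
  elim: k => [|k IH] kN; first by exists 0%N.
  have [m mS] := IH (ltnW kN).
  have [n _ nS] : (\bigcup_n S n) (f k) by apply: funS.
  exists (maxn m n) => i; rewrite ltnS leq_eqVlt => /orP[/eqP ->|/mS].
    by apply: Smono nS; rewrite leq_maxr.
  by apply: Smono; rewrite leq_maxl.
exists n; have := @inj_card_eq _ _ `I_N f (@inj _ _ _ f).
rewrite card_eq_le => /andP[_ /card_le_trans]; apply; apply: subset_card_le.
by move=> _ [i /= iN <-]; exact: nS.
Qed.

(** * Approximation of green clusters in finite boxes *)

Section green_box.
Implicit Types (x y : config cell color) (f g : {fset cell}) (n N : nat).

Definition green_in n x : set {fset cell} :=
  green x `&` [set f | (f `<=` box cell n)%fset].

Definition many_green n N f x : bool :=
  `[< (`I_N.+1 #<= graph_component faces_adjacent (green_in n x) f)%card >].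

Lemma green_bigcup x : green x = \bigcup_n green_in n x.
Proof.
apply/seteqP; split => f; last by move=> [n _ []].
by move=> xf; have [n /fsubsetP fn] := sub_box f; exists n.
Qed.

Lemma green_in_homo x : {homo green_in^~ x : m n / (m <= n)%N >-> m `<=` n}.
Proof.
by move=> m n mn f [xf /= fm]; split=> //=; apply: fsubset_trans fm _; exact: box_mono.
Qed.

Lemma many_green_bigcup N f :
  [set x | (`I_N.+1 #<= green_cluster x f)%card] = \bigcup_n [set x | many_green n N f x].
Proof.
have gm x : {homo (fun n => graph_component faces_adjacent (green_in n x) f) :
    m n / (m <= n)%N >-> m `<=` n}.
  by move=> m n mn; apply: sub_graph_component; exact: green_in_homo.
apply/seteqP; split => x /=; rewrite /green_cluster green_bigcup
    graph_component_bigcup; try exact: green_in_homo.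
  by move=> /(card_le_bigcup _ (gm x))[n nx]; exists n => //; apply/asboolP.
by move=> [n _ /asboolP nx]; apply/(card_le_bigcup _ (gm x)); exists n.
Qed.

Lemma many_green_homo N f : {homo (fun n => [set x | many_green n N f x]) :
  m n / (m <= n)%N >-> m `<=` n}.
Proof.
move=> m n mn x /asboolP mx; apply/asboolP; apply: card_le_trans mx _.
by apply: subset_card_le; apply: sub_graph_component; exact: green_in_homo.
Qed.

Lemma many_green_sub n N f x y : (forall v, x v = red \/ x v = y v) ->
  many_green n N f x -> many_green n N f y.
Proof.
move=> xy /asboolP nx; apply/asboolP; apply: card_le_trans nx _.
apply: subset_card_le; apply: sub_graph_component => g [[v [w [vw -> xv xw]]] gn].
split=> //; exists v, w; split=> //.
  by have [] := xy v; rewrite xv // => <-.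
by have [] := xy w; rewrite xw // => <-.
Qed.

Lemma dep_on_many_green n N f : dep_on [set` box cell n] (many_green n N f).
Proof.
move=> x y xy; rewrite /many_green (_ : green_in n x = green_in n y)//.
have H z t : (forall v, v \in box cell n -> z v = t v) -> green_in n z `<=` green_in n t.
  move=> zt g [[v [w [vw -> zv zw]]] /= gn]; split=> //; exists v, w; split=> //.
    by rewrite -(zt v) ?(fsubsetP gn) ?fset21.
  by rewrite -(zt w) ?(fsubsetP gn) ?fset22.
by apply/seteqP; split; apply: H => v /xy.
Qed.

End green_box.

Section green_proba.
Variables (R : realType) (p : color -> R).
Hypothesis tp : triangle p.

Let many_green_law n N f :
  measurable ([set x | many_green n N f x] : set (config cell color)) /\
  color_law p [set x | many_green n N f x] =
    (expect colors (fun=> p) (box cell n) (fun x => (many_green n N f x)%:R))%:E.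
Proof.
apply: (@local_event_law _ _ _ colors p _ _ _ (color_lawP tp)).
- exact: uniq_colors.
- exact: mem_colors.
- exact: fset_uniq.
- exact: dep_on_many_green.
Qed.

(** Continuity from below along the boxes turns the tail bound into bounds on finite
    expectations. *)
Lemma green_proba_le N f (c : R) :
  (color_law p [set x | (`I_N.+1 #<= green_cluster x f)%card] <= c%:E)%E <->
  forall n, expect colors (fun=> p) (box cell n) (fun x => (many_green n N f x)%:R) <= c.
Proof.
pose F n : set (config cell color) := [set x | many_green n N f x].
have mF n : measurable (F n) by have [] := many_green_law n N f.
have mU : measurable (\bigcup_n F n) by exact: bigcup_measurable.
rewrite many_green_bigcup -/F; split=> [h n|h].
  rewrite -lee_fin; have [_ <-] := many_green_law n N f.
  by apply: le_trans h; apply: le_measure; rewrite ?inE//; [exact: (mF n)|move=> x xn; exists n].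
have cvF : color_law p \o F @ \oo --> color_law p (\bigcup_n F n).
  apply: nondecreasing_cvg_mu => // m n mn; apply/subsetPset; exact: many_green_homo.
rewrite -(cvg_lim _ cvF)//; apply: lime_le.
  by apply/cvg_ex; exists (color_law p (\bigcup_n F n)).
by apply: nearW => n /=; have [_ ->] := many_green_law n N f; rewrite lee_fin.
Qed.

End green_proba.

(** * Monotonicity under recoloring of red cells *)

Section monotonicity.
Variables (R : realType) (p p' : color -> R).
Hypotheses (tp : triangle p) (tp' : triangle p').
Hypotheses (ley : p yellow <= p' yellow) (leb : p blue <= p' blue).

(** Site by site: the weight taken from red goes to yellow and blue, where the conditional
    expectation is at least as large. *)
Lemma expect_recolor (s : seq cell) (h : (cell -> color) -> R) :
  (forall x y, (forall v, x v = red \/ x v = y v) -> h x <= h y) ->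
  expect colors (fun=> p) s h <= expect colors (fun=> p') s h.
Proof.
have [p01 psum] := tp; have [p'01 p'sum] := tp'.
elim: s h => [|v s IH] h hi //=.
have hu a : expect colors (fun=> p) s (fun x => h (upd x v a)) <=
            expect colors (fun=> p') s (fun x => h (upd x v a)).
  apply: IH => x y xy; apply: hi => u; rewrite /upd.
  by case: ifP => // _; right.
have hr a : expect colors (fun=> p') s (fun x => h (upd x v red)) <=
            expect colors (fun=> p') s (fun x => h (upd x v a)).
  apply: le_expect => [_ c|x]; first by have /andP[] := p'01 c.
  by apply: hi => u; rewrite /upd; case: ifP; [left|right].
rewrite !big_cons !big_nil.
move: (hu red) (hu yellow) (hu blue) (hr yellow) (hr blue).
have /andP[pr _] := p01 red; have /andP[py _] := p01 yellow; have /andP[pb _] := p01 blue.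
move: psum p'sum ley leb; rewrite /=.
pose E (r : color -> R) a := expect colors (fun=> r) s (fun x => h (upd x v a)).
rewrite -!/(E _ _); move: (E p red) (E p yellow) (E p blue) (E p' red) (E p' yellow) (E p' blue).
move=> a1 a2 a3 b1 b2 b3.
move=> ps p's l1 l2 h1 h2 h3 h4 h5.
have : p red * a1 <= p red * b1 by rewrite ler_wpM2l.
have : p yellow * a2 <= p yellow * b2 by rewrite ler_wpM2l.
have : p blue * a3 <= p blue * b3 by rewrite ler_wpM2l.
have : (p' yellow - p yellow) * b1 <= (p' yellow - p yellow) * b2 by rewrite ler_wpM2l// subr_ge0.
have : (p' blue - p blue) * b1 <= (p' blue - p blue) * b3 by rewrite ler_wpM2l// subr_ge0.
have -> : p' red = p red - (p' yellow - p yellow) - (p' blue - p blue) by lra.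
lra.
Qed.

Lemma green_exp_decay_recolor : green_exp_decay p' -> green_exp_decay p.
Proof.
move=> [C [c [C0 c0 H]]]; exists C, c; split=> // N f ff.
apply/(green_proba_le tp) => n; apply: (le_trans _ ((green_proba_le tp' _ _ _).1 (H N f ff) n)).
apply: expect_recolor => x y xy; apply: ler_nat_bool; exact: many_green_sub.
Qed.

End monotonicity.

(** * From green clusters to clusters of retained cells *)

Lemma in_fset3 (K : choiceType) (x a b c : K) :
  (x \in [fset a; b; c]%fset) = [|| x == a, x == b | x == c].
Proof. by rewrite !inE orbA. Qed.

(** Both faces lie in one triple of mutually adjacent cells. Hence the ends of a given color along a
    path of green faces form a connected set. *)
Lemma faces_adjacent_bcc (a d a' d' : cell) :
  faces_adjacent [fset a; d]%fset [fset a'; d']%fset -> a' = a \/ a' \in bcc_nb a.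
Proof.
move=> [_ _ _ [u [v [w [uv vw uw /fsubsetP H1 /fsubsetP H2]]]]].
have A1 := H1 a (fset21 _ _).
have A2 := H2 a' (fset21 _ _).
move: A2 A1; rewrite !in_fset3.
rewrite !bcc_adjacentE in uv vw uw.
have vu := uv; have wv := vw; have wu := uw.
rewrite bcc_nbC in vu; rewrite bcc_nbC in wv; rewrite bcc_nbC in wu.
by move=> /or3P[] /eqP -> /or3P[] /eqP ->; auto.
Qed.

(** Following a path of green faces keeps their [c1] ends in one cluster, and each cell bounds at
    most 14 faces. Both [u] and [v] are seeds since either may be the [c1] end. *)
Lemma many_green_retained (c1 c2 : color) (n N : nat) (u v : cell) (x : config cell color) :
  (c1 = yellow /\ c2 = blue) \/ (c1 = blue /\ c2 = yellow) ->
  many_green n N [fset u; v]%fset x ->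
  (N < #|` site_cluster bcc_nb (box cell n) [set` [:: u; v]] (retained (box cell n) c1 c2 x)| * 14)%N.
Proof.
move=> c12 /asboolP; set cl := site_cluster _ _ _ _.
have greenE g : green_in n x g -> exists a d, [/\ g = [fset a; d]%fset, a \in box cell n,
    retained (box cell n) c1 c2 x a & d \in bcc_nb a].
  move=> [[a [d [ad -> xa xd]]] /= /fsubsetP gn].
  have an : a \in box cell n by apply: gn; exact: fset21.
  have dn : d \in box cell n by apply: gn; exact: fset22.
  rewrite bcc_adjacentE in ad; have da := ad; rewrite bcc_nbC in da.
  case: c12 => -[-> ->].
    exists a, d; split; [by []|exact: an| |exact: ad].
    by rewrite /retained an xa eqxx; apply/hasP; exists d; rewrite ?dn ?xd ?eqxx.
  exists d, a; split; [exact: fsetUC|exact: dn| |exact: da].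
  by rewrite /retained dn xd eqxx; apply/hasP; exists a; rewrite ?an ?xa ?eqxx.
have H g : graph_component faces_adjacent (green_in n x) [fset u; v]%fset g ->
    exists a d, [/\ g = [fset a; d]%fset, a \in cl & d \in bcc_nb a].
  move=> [fg /clos_rt_rtn1_iff]; elim=> [|g1 g2 [_ g2n g12] _ [a [d [g1E acl da]]]].
    have [a [d [fE an ra da]]] := greenE _ fg; exists a, d; split; [exact: fE| |exact: da].
    apply/clusterP; apply: reach_src; last by split.
    have : a \in [fset u; v]%fset by rewrite fE fset21.
    rewrite in_fset2 => auv; change (a \in [:: u; v]).
    by rewrite in_cons mem_seq1.
  have [a' [d' [g2E a'n ra' d'a']]] := greenE _ g2n; exists a', d'; split; [exact: g2E| |exact: d'a'].
  move: g12; rewrite g1E g2E => /faces_adjacent_bcc[->//|a'a].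
  exact: cluster_nb acl a'a a'n ra'.
pose s := [seq [fset z.1; z.2]%fset | z <- flatten [seq [seq (a, d) | d <- bcc_nb a] | a <- cl]].
have sP g : graph_component faces_adjacent (green_in n x) [fset u; v]%fset g -> g \in s.
  move=> /H[a [d [-> acl da]]]; apply/mapP; exists (a, d) => //.
  apply/flattenP; exists [seq (a, d) | d <- bcc_nb a]; first by apply/mapP; exists a.
  by apply/mapP; exists d.
have fin : finite_set (graph_component faces_adjacent (green_in n x) [fset u; v]%fset).
  by apply: (sub_finite_set sP); exact: finite_seq.
move=> /(leq_card_fset_set fin) /leq_trans; apply.
apply: (@leq_trans (size s)).
  by apply: uniq_leq_size => // g; rewrite in_fset_set// inE => /sP.
rewrite size_map size_flatten /shape -map_comp sumnE big_map.
apply: (@leq_trans (\sum_(a <- cl) 14)).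
  by apply: leq_sum => a _; rewrite /= size_map size_bcc_nb.
by rewrite big_const_seq count_predT iter_addn_0 mulnC.
Qed.

(** An exponential Markov inequality: with kap^14 <= tau, a green cluster of more than N faces
    forces kap^N <= tau^(size of the retained cluster), whose mean is at most K^2, there being two
    seeds. *)
Theorem green_exp_decay_subcritical (R : realType) (p : color -> R) (c1 c2 : color) (b : R) :
  triangle p -> (c1 = yellow /\ c2 = blue) \/ (c1 = blue /\ c2 = yellow) ->
  p c1 < 1 -> 0 <= b <= 1 -> p c2 <= b ^+ 14 * (1 - p c1) ->
  p c1 * (1 - (1 - b) ^+ 14) < p_c R -> green_exp_decay p.
Proof.
move=> tp c12 pc1 b01 pc2 qpc; set q := p c1 * _ in qpc.
have [p01 _] := tp; have /andP[pc10 _] := p01 c1.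
have /andP[t0 t1] : 0 <= 1 - (1 - b) ^+ 14 <= 1.
  have /andP[b0 b1] := b01.
  have b'0 : 0 <= 1 - b by rewrite subr_ge0.
  have b'1 : 1 - b <= 1 by rewrite gerBl.
  by rewrite subr_ge0 gerBl exprn_ge0// exprn_ile1.
have q0 : 0 <= q by rewrite mulr_ge0.
have q1 : q <= 1 by rewrite /q mulr_ile1// ltW.
have [|tau [K [tau1 K1 HK]]] := @cluster_moment_subcritical R q _ q1; first by rewrite q0.
have [kap kap1 kaptau] := exists_root_gt1 14 tau1.
have kap0 : 0 < kap by apply: lt_trans kap1.
exists (K ^+ 2), (ln kap); split; rewrite ?ln_gt0 ?exprn_gt0 ?(lt_trans _ K1)//.
move=> N f [u [v [_ ->]]]; apply/(green_proba_le tp) => n.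
pose F (w : cell -> bool) : R := tau ^+ #|` site_cluster bcc_nb (box cell n) [set` [:: u; v]] w|.
have Finc : increasing F.
  by move=> x y xy; rewrite /F ler_weXn2l ?(ltW tau1)// fsubset_leq_card// cluster_mono.
have kN0 : 0 <= (kap ^+ N)^-1 by rewrite invr_ge0 exprn_ge0// ltW.
have -> : expR (- ln kap * N%:R) = (kap ^+ N)^-1.
  by rewrite mulNr expRN mulrC expRM_natl lnK.
rewrite mulrC.
apply: (@le_trans _ _ (expect colors (fun=> p) (box cell n)
    (fun x => (kap ^+ N)^-1 * F (retained (box cell n) c1 c2 x)))).
  apply: le_expect => [_ c|x]; first by have /andP[] := p01 c.
  have F1 : 1 <= F (retained (box cell n) c1 c2 x) by rewrite exprn_ege1// ltW.
  case: (boolP (many_green _ _ _ _)) => [/(many_green_retained c12) mN|_]; last first.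
    by rewrite mulr_ge0// (le_trans ler01).
  rewrite mulrC ler_pdivlMr ?exprn_gt0// mul1r.
  apply: (@le_trans _ _ (kap ^+ (14 * #|` site_cluster bcc_nb (box cell n) [set` [:: u; v]] (retained (box cell n) c1 c2 x)|))).
    by rewrite ler_weXn2l ?(ltW kap1)// mulnC ltnW.
  by rewrite exprM /F lerXn2r// nnegrE ?exprn_ge0 ?(ltW kap0) ?(le_trans ler01 (ltW tau1)).
rewrite expectZ ler_wpM2l//.
apply: le_trans (retained_domination tp _ size_bcc_nb c12 pc1 b01 pc2 Finc) _.
exact: HK.
Qed.

(** * The separation curve *)

Section separation_curve.
Variable R : realType.
Implicit Types (p : color -> R) (x y : R).

Definition color_weights (r ye bl : R) (c : color) : R :=
  match c with red => r | yellow => ye | blue => bl end.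

Lemma triangle_color_weights r ye bl : 0 <= r -> 0 <= ye -> 0 <= bl -> r + ye + bl = 1 ->
  triangle (color_weights r ye bl).
Proof. by move=> r0 y0 b0 s1; split=> // -[] /=; apply/andP; split=> //; lra. Qed.

Lemma green_phase_recolor p p' : triangle p -> triangle p' ->
  p yellow <= p' yellow -> p blue <= p' blue -> green_phase p -> green_phase p'.
Proof.
by move=> tp tp' ly lb [_ np]; split=> // /(green_exp_decay_recolor tp tp' ly lb).
Qed.

Lemma strict_subcritical p (c1 c2 : color) :
  (c1 = yellow /\ c2 = blue) \/ (c1 = blue /\ c2 = yellow) ->
  triangle p -> (forall c, 0 < p c) -> p c1 <= p_c R ->
  exists2 d : R, 0 < d < p red / 2 &
    green_exp_decay (color_weights (p red - 2 * d) (p yellow + d) (p blue + d)).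
Proof.
move=> c12 [p01 psum] p0 pc1.
have s12 : p red + p c1 + p c2 = 1 by case: c12 => -[-> ->]; lra.
have pr := p0 red; have p1 := p0 c1; have p2 := p0 c2.
(* By Bernoulli's inequality b^14 >= 1 - p red / 2, whereas the conditional probability of [c2]
   given not [c1] is at most 1 - p red: this leaves room for [d]. *)
pose b : R := 1 - p red / 28.
have b01 : 0 <= b <= 1 by rewrite /b; apply/andP; split; lra.
have b14 : 1 - p red / 2 <= b ^+ 14.
  suff H n : 1 - p red / 28 * n%:R <= b ^+ n.
    by have := H 14; apply: le_trans; lra.
  elim: n => [|n IH]; first by rewrite expr0; lra.
  rewrite exprS -[n.+1%:R]natr1; have := ler_wpM2l (_ : 0 <= b) IH; have /andP[b0 _] := b01.
  have n0 : 0 <= (p red / 28) ^+ 2 * n%:R by rewrite mulr_ge0// sqr_ge0.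
  move=> /(_ b0); set B := b ^+ n; move: n0; rewrite /b expr2; lra.
set kappa := 1 - (1 - b) ^+ 14.
have k01 : 0 <= kappa < 1.
  rewrite /kappa subr_ge0 ltrBlDr ltrDl exprn_gt0 ?exprn_ile1//; rewrite /b; lra.
have pk : p c1 * kappa < p_c R.
  by apply: lt_le_trans pc1; rewrite gtr_pMr//; case/andP: k01.
(* The first bound preserves the condition on [c2]; the second uses at most half of the gap between
   p_c and [p c1 * kappa], positive because kappa < 1. *)
pose d := Num.min (p red / 4) ((p_c R - p c1 * kappa) / 2).
have d0 : 0 < d by rewrite lt_min; apply/andP; split; lra.
have d1 : d <= p red / 4 by rewrite ge_min lexx.
have d2 : d <= (p_c R - p c1 * kappa) / 2 by rewrite ge_min lexx orbT.
exists d; first by apply/andP; split; lra.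
set p' := color_weights _ _ _.
have E1 : p' c1 = p c1 + d by case: c12 => -[-> _].
have E2 : p' c2 = p c2 + d by case: c12 => -[_ ->].
clearbody d.
apply: (@green_exp_decay_subcritical _ p' c1 c2 b) => //.
- by apply: triangle_color_weights; have := p0 yellow; have := p0 blue; lra.
- by rewrite E1; lra.
- rewrite E1 E2; move: b14; set B := b ^+ 14 => b14.
  have : (1 - p red / 2) * (1 - (p c1 + d)) <= B * (1 - (p c1 + d)).
    by apply: ler_wpM2r => //; lra.
  by apply: le_trans; nra.
- rewrite E1 -/kappa mulrDl; have : d * kappa <= d by rewrite ler_piMr ?(ltW d0)//; case/andP: k01 => _ /ltW.
  by lra.
Qed.

Definition green_heights x : set R :=
  [set y | exists p, [/\ green_phase p, plane_x p = x & plane_y p = y]].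

(** Adjoining 0 gives the curve height 0 over columns that contain no point of the green phase. *)
Definition separation_height x : R := sup (0 |` green_heights x).

Local Notation s3 := (Num.sqrt 3 : R).

Lemma sqrt3_gt0 : 0 < s3. Proof. by rewrite sqrtr_gt0. Qed.

Lemma green_heights_ub x : `|x| <= 1 / 2 -> ubound (0 |` green_heights x) (s3 / 2 * (1 - 2 * `|x|)).
Proof.
move=> x2 y [->|[p [[[p01 psum] _] <- <-]]].
  by rewrite mulr_ge0 ?divr_ge0 ?(ltW sqrt3_gt0)//; lra.
rewrite /plane_y ler_wpM2l ?divr_ge0 ?(ltW sqrt3_gt0)//.
have := p01 yellow; have := p01 blue => /andP[b0 _] /andP[y0 _].
rewrite /plane_x; have [h|h] := leP 0 ((p blue - p yellow) / 2).
  by rewrite ger0_norm//; lra.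
by rewrite ltr0_norm//; lra.
Qed.

Lemma green_heights_has_sup x : `|x| <= 1 / 2 -> has_sup (0 |` green_heights x).
Proof. by move=> x2; split; [exists 0; left|eexists; exact: green_heights_ub]. Qed.

Lemma separation_height_ge0 x : `|x| <= 1 / 2 -> 0 <= separation_height x.
Proof. by move=> x2; apply: sup_upper_bound; [exact: green_heights_has_sup|left]. Qed.

Lemma separation_height_le x : `|x| <= 1 / 2 -> separation_height x <= s3 / 2 * (1 - 2 * `|x|).
Proof. by move=> x2; apply: ge_sup; [exists 0; left|exact: green_heights_ub]. Qed.

Lemma separation_height_ge p : `|plane_x p| <= 1 / 2 -> green_phase p -> plane_y p <= separation_height (plane_x p).
Proof.
by move=> x2 gp; apply: sup_upper_bound; [exact: green_heights_has_sup|right; exists p].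
Qed.

(** Shift a point of the green phase above [x]: taking 2 D from red, with D the horizontal distance,
    and sharing it suitably between yellow and blue reaches the column of [x'] within the green
    phase, at the cost of a height sqrt 3 D. If red has at most 2 D, the point is no higher than
    sqrt 3 D. *)
Lemma separation_height_lip x x' : `|x| <= 1 / 2 -> `|x'| <= 1 / 2 ->
  separation_height x <= separation_height x' + s3 * `|x - x'|.
Proof.
move=> x2 x'2; apply: ge_sup; first by exists 0; left.
have n0 : 0 <= s3 * `|x - x'| by rewrite mulr_ge0// ltW.
have h0 := separation_height_ge0 x'2.
move=> _ [->|[p [gp px <-]]]; first by rewrite addr_ge0.
set D := `|x - x'| in n0 *.
have [pD|pD] := leP (p red) (2 * D).
  have : plane_y p <= s3 / 2 * (2 * D).
    by rewrite /plane_y ler_wpM2l ?divr_ge0 ?(ltW sqrt3_gt0).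
  by rewrite (_ : s3 / 2 * (2 * D) = s3 * D); [lra|field].
have [[p01 psum] _] := gp.
have h1 : x - x' <= D by exact: ler_norm.
have h2 : x' - x <= D by rewrite /D distrC ler_norm.
have := p01 yellow; have := p01 blue => /andP[b0 _] /andP[y0 _].
pose p' := color_weights (p red - 2 * D) (p yellow + (D - (x' - x))) (p blue + (D + (x' - x))).
have gp' : green_phase p'.
  apply: green_phase_recolor gp => //; rewrite /p' /=; try lra.
  by apply: triangle_color_weights; lra.
have p'x : plane_x p' = x'.
  rewrite /plane_x /p' /=; move: px; rewrite /plane_x => px.
  by rewrite -[LHS]/((p blue + (D + (x' - x)) - (p yellow + (D - (x' - x)))) / 2); lra.
have := @separation_height_ge p'; rewrite p'x => /(_ x'2 gp'); rewrite /plane_y /= => h.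
rewrite -lerBlDr (le_trans _ h)//.
by rewrite le_eqVlt; apply/orP; left; apply/eqP; field.
Qed.

Lemma plane_x_bound p : triangle p -> `|plane_x p| <= 1 / 2.
Proof.
move=> [p01 psum]; rewrite ler_norml /plane_x.
have := p01 yellow; have := p01 blue => /andP[b0 b1] /andP[y0 y1].
by apply/andP; split; lra.
Qed.

(** Going down a vertical line moves weight from red equally to yellow and blue, which preserves the
    green phase. *)
Lemma green_phase_below p : triangle p -> 0 < plane_y p < separation_height (plane_x p) -> green_phase p.
Proof.
move=> tp /andP[y0 yh]; have x2 := plane_x_bound tp.
have [|y' [yy'|[p' [gp' px py]]] lty] := sup_gt _ yh; first by exists 0; left.
  by move: lty; rewrite yy' ltNge ltW.
have [[_ p'sum] _] := gp'; have [_ psum] := tp.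
have rr : p red < p' red.
  by move: lty; rewrite -py /plane_y ltr_pM2l// divr_gt0.
by move: px; rewrite /plane_x => px; apply: green_phase_recolor (gp') => //; [by have [] := gp'|lra|lra].
Qed.

(** If [p c1] were at most p_c, [strict_subcritical] would give exponential decay at a point
    straight below [p], at positive height under the curve, hence in the green phase. *)
Lemma separation_height_strict p (c1 c2 : color) :
  (c1 = yellow /\ c2 = blue) \/ (c1 = blue /\ c2 = yellow) ->
  triangle p -> (forall c, 0 < p c) -> plane_y p = separation_height (plane_x p) -> p_c R < p c1.
Proof.
move=> c12 tp p0 py; rewrite ltNge; apply/negP => pc1.
have [d /andP[d0 dr] dec] := strict_subcritical c12 tp p0 pc1.
move: dec; set p' := color_weights _ _ _ => dec.
have tp' : triangle p'.
  by have [_ psum] := tp; apply: triangle_color_weights; have := p0 yellow; have := p0 blue; lra.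
have p'x : plane_x p' = plane_x p by rewrite /plane_x /p' /=; congr (_ / 2); ring.
have p'y : 0 < plane_y p' < plane_y p.
  by rewrite /plane_y /p' /= mulr_gt0 ?divr_gt0 ?ltr_pM2l ?divr_gt0//=; lra.
by have [_] : green_phase p' by apply: green_phase_below => //; rewrite p'x -py.
Qed.

End separation_curve.

Theorem theorem1p5 (R : realType) :
  exists h : R -> R,
  [/\ forall x, x \in `[- (1 / 2), 1 / 2] -> 0 <= h x <= Num.sqrt 3 / 2,
      (Num.sqrt 3).-lipschitz_(`[- (1 / 2), 1 / 2]%classic) h,
      forall x, x \in `[- (1 / 2), 1 / 2] ->
        exists p, [/\ triangle p, plane_x p = x & plane_y p = h x],
      forall p, triangle p ->
        (0 < plane_y p < h (plane_x p) -> green_phase p) /\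
        (h (plane_x p) < plane_y p -> ~ green_phase p) &
      forall p, triangle p -> plane_y p = h (plane_x p) ->
        ~ triangle_boundary p -> p_c R < p yellow /\ p_c R < p blue].
Proof.
exists (@separation_height R); have s3_ge0 := ltW (sqrt3_gt0 R).
have itv (x : R) : x \in `[- (1 / 2), 1 / 2] -> `|x| <= 1 / 2 by rewrite in_itv /= ler_norml.
split.
- move=> x /itv x2; rewrite separation_height_ge0//= (le_trans (separation_height_le x2))//.
  by rewrite ler_piMr ?divr_ge0 ?s3_ge0// gerBl mulr_ge0.
- move=> [x x'] [] /= /itv x2 /itv x'2.
  rewrite ler_distl; apply/andP; split.
    by rewrite lerBlDr distrC separation_height_lip.
  exact: separation_height_lip.
- move=> x /itv x2; have h0 := separation_height_ge0 x2; have h1 := separation_height_le x2.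
  (* The red weight at height h(x); the abscissa determines the other two weights, nonnegative by
     [separation_height_le]. *)
  pose r := separation_height x / (Num.sqrt 3 / 2).
  have r0 : 0 <= r by rewrite divr_ge0 ?divr_ge0 ?s3_ge0.
  have r1 : r <= 1 - 2 * `|x| by rewrite ler_pdivrMr ?divr_gt0 ?sqrt3_gt0// mulrC.
  have := ler_norm x; have := ler_norm (- x); rewrite normrN => l1 l2.
  exists (color_weights r ((1 - r) / 2 - x) ((1 - r) / 2 + x)); split.
  + by apply: triangle_color_weights; lra.
  + by rewrite /plane_x /=; lra.
  + by rewrite /plane_y /= mulrC divfK// gt_eqF ?divr_gt0 ?sqrt3_gt0.
- move=> p tp; split; first exact: green_phase_below.
  by move=> hp gp; have := separation_height_ge (plane_x_bound tp) gp; rewrite leNgt hp.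
- move=> p tp py nb; have p0 c : 0 < p c.
    have [p01 _] := tp; have /andP[c0 _] := p01 c.
    rewrite lt_def c0 andbT; apply/eqP => pc0; apply: nb; split=> //; by exists c.
  split.
  + by apply: (separation_height_strict _ tp p0 py (c2 := blue)); left.
  + by apply: (separation_height_strict _ tp p0 py (c2 := yellow)); right.
Qed.
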